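(* Let $\{d_n\}_{n=0}^\infty$ be a sequence with $d_n\in\{0,1\}$ for all $n\in\mathbb{N}$, $d_0=0$, and $d_n=1$ for infinitely many $n$. Consider the random graph process with sequence $\{d_n\}$. (i) If $\sum_{i=1}^\infty\frac{d_i}{i}=\infty$, then the space is concentrated, and the atom is a graph whose components are $\omega$-trees, and the number of components is equal to the number of zeroes in the sequence $\{d_n\}_{n\ge 0}$. (ii) Suppose $\sum_{i=1}^\infty\frac{d_i}{i}<\infty$. Let $t_n=\sum_{i=n}^\infty\frac{d_i}{i}$ for $n\ge 1$, and let $k=\min\{\kappa\ge 2:\sum_{l=1}^\infty d_l\, t_{l+1}^{\kappa-2}<\infty\}$, where $\kappa$ ranges over integers and $k=\infty$ if the set is empty. Then the space has infinitely many atoms, and all of them are of the form $F\cup\left[\bigcup_{1\le i<k}F_i\right]$ (disjoint union), where $F$ is some finite forest.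
   Context: Random graph process with sequence $\{d_n\}$ (where $0\le d_n\le n$): the vertex set is $\{v_0,v_1,v_2,\ldots\}$. In round $i=0,1,2,\ldots$, independently of the other rounds, a subset $A\subseteq\{v_0,\ldots,v_{i-1}\}$ of cardinality $d_i$ is chosen uniformly at random among all subsets of that cardinality, and $v_i$ is joined by an edge to every vertex of $A$. The result is a random graph on countably many vertices. The probability space is concentrated if there is a graph $G$ such that the process generates a graph isomorphic to $G$ with probability $1$. A graph $G$ is an atom of the space if the process generates a graph isomorphic to $G$ with positive probability (atoms are considered up to isomorphism). The $\omega$-tree is the unique countably infinite tree in which every vertex has infinite degree. For a finite tree $T$, $F_T$ is the forest whose components are countably infinitely many copies of $T$. For $n\ge 1$, $F_n$ is the disjoint union of the forests $F_T$ over all (isomorphism types of) trees $T$ of size $n$, i.e. with $n$ vertices. So $F_1$ is the countably infinite edgeless graph and $F_2$ is the countably infinite matching.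
   Formalization: In (ii), ''infinitely many atoms'' is claimed only for finite k; for k = ∞ it is replaced by ''the space is concentrated'', since then adding a finite forest F to the union of all F_i changes nothing, so at most one atom can have the stated form. *)

(* Defs.v *)
From HB Require Import structures.
From mathcomp Require Import all_boot all_order all_algebra.
From mathcomp Require Import all_classical all_reals all_analysis.
From Stdlib Require Export Relation_Operators.
Import Order.TTheory GRing.Theory Num.Theory.

Set Implicit Arguments.
Unset Strict Implicit.
Unset Printing Implicit Defensive.

Local Open Scope classical_set_scope.
Local Open Scope card_scope.
Local Open Scope ring_scope.

(** * Simple graphs on an arbitrary vertex type *)

Record sgraph (V : Type) := SGraph {
  adj : V -> V -> Prop;
  adj_sym : forall x y, adj x y -> adj y x;
  adj_irr : forall x, ~ adj x x }.

Definition iso (V W : Type) (G : sgraph V) (H : sgraph W) : Prop :=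
  exists f : V -> W, bijective f /\ forall x y, adj G x y <-> adj H (f x) (f y).

Definition reachable (V : Type) (G : sgraph V) : V -> V -> Prop :=
  clos_refl_trans V (adj G).

Definition components (V : Type) (G : sgraph V) : set (set V) :=
  [set C | exists v, C = [set w | reachable G v w]].

Definition induced_subgraph (V : Type) (G : sgraph V) (C : set V) : sgraph C :=
  @SGraph C (fun x y => adj G (val x) (val y))
    (fun x y => @adj_sym V G (val x) (val y)) (fun x => @adj_irr V G (val x)).

Definition acyclic (V : Type) (G : sgraph V) : Prop :=
  ~ exists (n : nat) (c : 'I_n -> V),
      [/\ (2 < n)%N, injective c & forall i, adj G (c i) (c (ordS i))].

Definition tree (V : Type) (G : sgraph V) : Prop :=
  [/\ inhabited V, forall x y, reachable G x y & acyclic G].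

Definition omega_tree (V : Type) (G : sgraph V) : Prop :=
  [/\ tree G, [set: V] #= [set: nat] &
      forall v, infinite_set [set w | adj G v w]].

(** * Disjoint unions *)

Inductive sum_adj (V W : Type) (G : sgraph V) (H : sgraph W) :
    V + W -> V + W -> Prop :=
| SumL x y of adj G x y : sum_adj G H (inl x) (inl y)
| SumR x y of adj H x y : sum_adj G H (inr x) (inr y).

Lemma sum_adj_sym V W (G : sgraph V) (H : sgraph W) u v :
  sum_adj G H u v -> sum_adj G H v u.
Proof. by case=> x y e; constructor; exact: adj_sym. Qed.

Lemma sum_adj_irr V W (G : sgraph V) (H : sgraph W) u : ~ sum_adj G H u u.
Proof.
case: u => x h; inversion h; subst; [exact: (@adj_irr V G x)|].
exact: (@adj_irr W H x).
Qed.

Definition gsum V W (G : sgraph V) (H : sgraph W) : sgraph (V + W) :=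
  SGraph (@sum_adj_sym V W G H) (@sum_adj_irr V W G H).

Inductive bigsum_adj (I : Type) (V : I -> Type) (G : forall i, sgraph (V i)) :
    {i : I & V i} -> {i : I & V i} -> Prop :=
| BigSum i x y of adj (G i) x y : bigsum_adj G (existT _ i x) (existT _ i y).

Lemma bigsum_adj_sym I (V : I -> Type) (G : forall i, sgraph (V i)) u v :
  bigsum_adj G u v -> bigsum_adj G v u.
Proof. by case=> i x y e; constructor; exact: adj_sym. Qed.

Lemma bigsum_adj_irr I (V : I -> Type) (G : forall i, sgraph (V i)) u :
  ~ bigsum_adj G u u.
Proof.
have inv v : bigsum_adj G u v -> exists e : tag u = tag v,
    adj (G _) (eq_rect _ V (tagged u) _ e) (tagged v).
  by case=> i x y e; exists erefl.
case/inv=> e; rewrite (Prop_irrelevance e erefl) /=; exact: adj_irr.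
Qed.

Definition bigsum I (V : I -> Type) (G : forall i, sgraph (V i)) :
    sgraph {i : I & V i} :=
  SGraph (@bigsum_adj_sym I V G) (@bigsum_adj_irr I V G).

(** * The forests [F_T] and [F_n] *)

Definition F_tree (V : Type) (T : sgraph V) : sgraph {_ : nat & V} :=
  bigsum (fun _ : nat => T).

Definition labelled_tree (n : nat) := {T : sgraph 'I_n | tree T}.

(* Isomorphism types of trees with n vertices: isomorphism classes of trees
   labelled by 'I_n. *)
Definition tree_type (n : nat) :=
  {C : set (labelled_tree n) |
    exists T : labelled_tree n,
      C = [set U : labelled_tree n | iso (sval T) (sval U)]}.

Lemma tree_type_inhabited n (c : tree_type n) : exists T, sval c T.
Proof.
case: c => C /= [T ->]; exists T; exists id; split => //.
by exists id.
Qed.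

Definition representative n (c : tree_type n) : sgraph 'I_n :=
  sval (sval (cid (tree_type_inhabited c))).

Definition F_size (n : nat) : sgraph {c : tree_type n & {_ : nat & 'I_n}} :=
  bigsum (fun c : tree_type n => F_tree (representative c)).

(** * The random graph process *)

(* [A i w] is the subset of {v_0, ..., v_{i-1}} to which v_i is joined. *)
Definition generated (T : Type) (A : forall i : nat, T -> {set 'I_i}) (w : T)
    (x y : nat) : Prop :=
  (exists h : (x < y)%N, Ordinal h \in A y w) \/
  (exists h : (y < x)%N, Ordinal h \in A x w).

Lemma generated_sym T A w x y : @generated T A w x y -> generated A w y x.
Proof. by case=> ?; [right|left]. Qed.

Lemma generated_irr T A w x : ~ @generated T A w x x.
Proof. by case=> -[h _]; move: (h); rewrite ltnn. Qed.

Definition random_graph T (A : forall i : nat, T -> {set 'I_i}) (w : T) :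
    sgraph nat :=
  SGraph (@generated_sym T A w) (@generated_irr T A w).

Section process.
Context (R : realType) (disp : measure_display) (T : measurableType disp).
Context (P : probability T R).

Definition uniform_subset (n k : nat) (X : T -> {set 'I_n}) : Prop :=
  forall B : {set 'I_n},
    P (X @^-1` [set B]) =
    (if #|B| == k then ('C(n, k)%:R)^-1 else 0 : R)%:E.

Definition independent_rounds (A : forall i : nat, T -> {set 'I_i}) : Prop :=
  forall (J : seq nat) (E : forall i : nat, set {set 'I_i}), uniq J ->
    P (\bigcap_(i in [set` J]) (A i @^-1` E i)) =
    (\prod_(i <- J) P (A i @^-1` E i))%E.

Definition graph_process (d : nat -> nat) (A : forall i : nat, T -> {set 'I_i}) :
    Prop :=
  [/\ forall i, (d i <= i)%N,
      forall i (B : {set 'I_i}), measurable (A i @^-1` [set B]),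
      forall i, uniform_subset (d i) (A i) &
      independent_rounds A].

Definition concentrated (A : forall i : nat, T -> {set 'I_i}) : Prop :=
  exists (V : Type) (G : sgraph V), {ae P, forall w, iso (random_graph A w) G}.

(* Isomorphism classes of countable graphs are Borel, so being non-negligible
   is having positive probability; this form does not evaluate P on an event
   before it is known to be measurable. *)
Definition atom (A : forall i : nat, T -> {set 'I_i}) (V : Type) (G : sgraph V) :
    Prop :=
  ~ P.-negligible [set w | iso (random_graph A w) G].

Definition infinitely_many_atoms (A : forall i : nat, T -> {set 'I_i}) : Prop :=
  exists (V : nat -> Type) (G : forall m, sgraph (V m)),
    (forall m, atom A (G m)) /\ (forall m p, m <> p -> ~ iso (G m) (G p)).

End process.

(** * The number k *)

(* The minimum of a set of natural numbers; [None] stands for infinity. *)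
Definition min_or_infinity (K : nat -> Prop) : option nat :=
  match pselect (exists n, `[< K n >]) with
  | left ex => Some (ex_minn ex)
  | right _ => None
  end.

Definition lt_or_infinity (i : nat) (k : option nat) : Prop :=
  if k is Some m then (i < m)%N else True.

Section threshold.
Context (R : realType) (d : nat -> nat).

Definition tail (n : nat) : \bar R :=
  (\sum_(n <= i <oo) ((d i)%:R / i%:R)%:E)%E.

Definition threshold : option nat :=
  min_or_infinity (fun kappa => (2 <= kappa)%N /\
    (\sum_(1 <= l <oo) ((d l)%:R%:E * tail l.+1 ^+ (kappa - 2)) < +oo)%E).

End threshold.

(* The disjoint union of the F_i over 1 <= i < k. For k infinite it contains
   infinitely many copies of every finite tree, so adding a finite forest to it
   does not change its isomorphism type: at most one graph, up to isomorphism,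
   is then of the form F + F_below k, and a space all of whose atoms have this
   form has at most one atom. *)
Definition F_below (k : option nat) :=
  bigsum (fun i : {i : nat | (1 <= i)%N /\ lt_or_infinity i k} =>
    F_size (sval i)).

(* Main.v *)
Require Import Defs.
From Stdlib Require Import Operators_Properties.
From mathcomp Require Import all_boot all_order all_algebra finmap.
From mathcomp Require Import all_classical all_reals all_analysis.
From mathcomp Require Import measurable_realfun zify ring lra.
Import Order.TTheory GRing.Theory Num.Theory.
Import numFieldNormedType.Exports.

Set Implicit Arguments.
Unset Strict Implicit.
Unset Printing Implicit Defensive.

Local Open Scope classical_set_scope.
Local Open Scope card_scope.
Local Open Scope ring_scope.

(** Joining [v_i] to its neighbour among the earlier vertices, whenever
    [d i = 1], makes the graph a forest in which that neighbour is the parent of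
    [v_i]. The components correspond to the vertices without parent, that is, to
    the zeroes of [d]. A given earlier vertex is the parent of [v_i] with
    probability [x i = d i / i], and different rounds are independent.

    If the sum of the [x i] diverges, every vertex almost surely has infinitely
    many children ([ae_infinitely_many_children], a second Borel-Cantelli
    argument). A forest with this property is determined by its set of roots: a
    vertex is given by the root of its component and by the ranks among their
    siblings of the vertices on the path from that root
    ([parent_graph_omega_forest]).

    If the sum converges, with tails [t n], a vertex [v] lies below [r] with
    probability [O(x v)], hence all components are finite
    ([ae_finite_components]). It remains to count the components of each size
    [m + 2]. Such a component is built by choosing its root [r], its second
    vertex [l], and then [m] further vertices that join it. Since most terms of
    [d] are zeroes, there are about [l] choices of [r], which compensates the
    probability [1 / l] that [l] chooses a given [r]; the further vertices
    contribute the elementary symmetric sum of degree [m] in the [x i] with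
    [i > l], which is [t (l + 1) ^ m / m!] up to an error whose sum over the [l]
    with [d l = 1] converges. So the expected number of these components is
    comparable to the sum of the [d l * t (l + 1) ^ m].
    - If that sum converges, a union bound over the possible shapes and the first
      Borel-Cantelli lemma leave finitely many components with at least [m + 2]
      vertices ([ae_finitely_many_large]).
    - If it diverges, every tree with [m + 2] vertices occurs infinitely often as
      a component ([ae_shape_occurs]). Two different sets of vertices cannot
      both be components unless they are disjoint, and for disjoint sets the
      events are nearly independent, so a second moment bound applies
      ([second_moment]). Discarding the vertices before [N] makes the
      probability that a later vertex spoils a given component at most a
      multiple of [t N], which tends to zero. The same argument gives infinitely
      many isolated vertices.
    The components with fewer than [k] vertices thus form a copy of [F_below k]
    and the other ones a finite forest ([parent_graph_F_below]).

    For finite [k] the graphs [F + F_below k] with [F] a finite forest form a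
    countable family that is almost surely met, so for every [n] a member with a
    component of [n] vertices is an atom, because [n] chosen vertices join [v_0]
    with positive probability. As the component sizes of each member are bounded,
    infinitely many of these atoms are pairwise non-isomorphic
    ([finite_threshold_infinitely_many_atoms]). *)

(** * Graphs up to isomorphism *)

Lemma inj_surj_bijective (V W : Type) (f : V -> W) :
  injective f -> (forall y, exists x, f x = y) -> bijective f.
Proof.
move=> finj fsurj; exists (fun y => sval (cid (fsurj y))) => [x|y].
  by apply: finj; exact: svalP (cid (fsurj (f x))).
exact: svalP (cid (fsurj y)).
Qed.

Lemma iso_sym (V W : Type) (G : sgraph V) (H : sgraph W) : iso G H -> iso H G.
Proof.
case=> f [[g fK gK] fadj]; exists g; split; first by exists f.
by move=> x y; rewrite fadj !gK.
Qed.

Lemma iso_trans (U V W : Type) (F : sgraph U) (G : sgraph V) (H : sgraph W) :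
  iso F G -> iso G H -> iso F H.
Proof.
case=> f [fbij fadj] [g [gbij gadj]]; exists (g \o f); split.
  exact: bij_comp.
by move=> x y; rewrite fadj gadj.
Qed.

Lemma reachable_sym (V : Type) (G : sgraph V) x y :
  reachable G x y -> reachable G y x.
Proof.
elim=> [a b ab|a|a b c _ ba _ cb]; first exact/rt_step/adj_sym.
  exact: rt_refl.
exact: rt_trans cb ba.
Qed.

Lemma reachable_map (V W : Type) (G : sgraph V) (H : sgraph W) (f : V -> W) :
  (forall x y, adj G x y -> adj H (f x) (f y)) ->
  forall x y, reachable G x y -> reachable H (f x) (f y).
Proof.
move=> fadj x y; elim=> [a b ab|a|a b c _ ab _ bc]; first exact/rt_step/fadj.
  exact: rt_refl.
exact: rt_trans ab bc.
Qed.

Lemma acyclic_inj (V W : Type) (G : sgraph V) (H : sgraph W) (f : V -> W) :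
  injective f -> (forall x y, adj G x y -> adj H (f x) (f y)) ->
  acyclic H -> acyclic G.
Proof.
move=> finj fadj Hac [n [c [n2 cinj cadj]]]; apply: Hac.
exists n, (f \o c); split=> // [|i]; first exact: inj_comp.
exact/fadj/cadj.
Qed.

Definition pullback (V W : Type) (f : V -> W) (H : sgraph W) : sgraph V :=
  @SGraph V (fun x y => adj H (f x) (f y))
    (fun x y => @adj_sym W H (f x) (f y)) (fun x => @adj_irr W H (f x)).

(** A walk that starts in a set closed under adjacency stays in it. *)
Lemma reachable_pullback (V W : Type) (f : V -> W) (H : sgraph W) :
  injective f -> (forall x w, adj H (f x) w -> exists y, f y = w) ->
  forall x y, reachable H (f x) (f y) -> reachable (pullback f H) x y.
Proof.
move=> finj fclosed x y /(@clos_rt_rtn1 _ _ _ _).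
suff from w : clos_refl_trans_n1 W (adj H) (f x) w ->
    exists2 y', f y' = w & reachable (pullback f H) x y'.
  by case/from=> y' /finj ->.
elim=> [|a b ab _ [y' y'a xy']]; first by exists x => //; exact: rt_refl.
have [z zb] : exists z, f z = b by apply: (fclosed y'); rewrite y'a.
exists z => //; apply: rt_trans xy' _; apply: rt_step.
by rewrite /= y'a zb.
Qed.

Lemma gsum_iso_l (V V' W : Type) (F : sgraph V) (F' : sgraph V') (H : sgraph W) :
  iso F F' -> iso (gsum F H) (gsum F' H).
Proof.
case=> f [[g fK gK] fadj].
exists (fun u => match u with inl x => inl (f x) | inr y => inr y end); split.
  exists (fun u => match u with inl x => inl (g x) | inr y => inr y end).
    by case=> // x; rewrite fK.
  by case=> // x; rewrite gK.
case=> x [] y; split=> h; inversion h; subst; constructor => //.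
  by rewrite -fadj.
by rewrite fadj.
Qed.

(** * Forests given by a parent function *)

Definition parent_decreases (p : nat -> option nat) :=
  forall i j, p i = Some j -> (j < i)%N.

Section ParentForest.
Variable p : nat -> option nat.

Let padj x y := (p x = Some y /\ (y < x)%N) \/ (p y = Some x /\ (x < y)%N).

Let padj_sym x y : padj x y -> padj y x.
Proof. by case; [right|left]. Qed.

Let padj_irr x : ~ padj x x.
Proof. by case=> -[_]; rewrite ltnn. Qed.

(** The comparisons make this a simple graph for every function [p]. *)
Definition parent_graph : sgraph nat := SGraph padj_sym padj_irr.

(** A cycle would give its largest vertex two smaller neighbours, both equal
    to its parent. *)
Lemma parent_graph_acyclic : acyclic parent_graph.
Proof.
move=> [[|n] [c [n2 cinj cadj]]]; first by [].
have [i _ imax] := @arg_maxnP _ ord0 predT c isT.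
have down x y : (y <= x)%N -> adj parent_graph x y -> p x = Some y.
  by move=> yx [[//]|[_]]; rewrite ltnNge yx.
have pS := down _ _ (imax (ordS i) isT) (cadj i).
have := cadj (ord_pred i); rewrite ord_predK => /(@adj_sym _ _ _ _).
move=> /(down _ _ (imax (ord_pred i) isT)); rewrite pS => -[/cinj].
move=> /(congr1 val) /=; case: i {imax pS} => i /= il.
have [->|in1] := eqVneq i n.
  have -> : (n + n.+1).-1 = (n.-1 + n.+1)%N by lia.
  by rewrite modnn modnDr modn_small; lia.
have [->|i0] := posnP i; first by rewrite add0n /= !modn_small //; lia.
have -> : (i + n.+1).-1 = (i.-1 + n.+1)%N by lia.
by rewrite modnDr !modn_small; lia.
Qed.

Hypothesis p_lt : parent_decreases p.

Lemma parent_adj x y :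
  adj parent_graph x y <-> p x = Some y \/ p y = Some x.
Proof.
by split=> -[]; [case; left|case; right|left; split; auto|right; split; auto].
Qed.

Fixpoint ancestor k v := 
  if k is k'.+1 then if p v is Some u then ancestor k' u else v else v.

(** [v] is enough fuel, since each step to a parent decreases the vertex. *)
Definition root_of v := ancestor v v.

Let ancestor_fuel k l v : (v <= k)%N -> (v <= l)%N -> ancestor k v = ancestor l v.
Proof.
elim: k l v => [|k ih] [|l] v //=.
- by rewrite leqn0 => /eqP -> _; case E: (p 0%N) => [u|] //; have := p_lt E.
- by move=> _; rewrite leqn0 => /eqP ->; case E: (p 0%N) => [u|] //; have := p_lt E.
- move=> vk vl; case E: (p v) => [u|] //; have := p_lt E => uv.
  by apply: ih; lia.
Qed.

Lemma rootE v : root_of v = if p v is Some u then root_of u else v.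
Proof.
rewrite /root_of; case: v => [|v] /=.
  by case E: (p 0%N) => [u|] //; have := p_lt E.
case E: (p v.+1) => [u|] //; have := p_lt E => uv.
by apply: ancestor_fuel; lia.
Qed.

Lemma root_parent v u : p v = Some u -> root_of v = root_of u.
Proof. by move=> vu; rewrite rootE vu. Qed.

Lemma root_id v : p v = None -> root_of v = v.
Proof. by move=> v0; rewrite rootE v0. Qed.

Lemma rootP v : p (root_of v) = None.
Proof.
elim/ltn_ind: v => v ih; rewrite rootE; case E: (p v) => [u|] //.
exact/ih/p_lt.
Qed.

Lemma root_le v : (root_of v <= v)%N.
Proof.
elim/ltn_ind: v => v ih; rewrite rootE; case E: (p v) => [u|] //.
by have uv := p_lt E; exact: leq_trans (ih _ uv) (ltnW uv).
Qed.

Lemma reachable_root v : reachable parent_graph v (root_of v).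
Proof.
elim/ltn_ind: v => v ih; rewrite rootE; case E: (p v) => [u|]; last exact: rt_refl.
apply: rt_trans (ih u (p_lt E)); apply: rt_step; apply/parent_adj; by left.
Qed.

Lemma reachableP x y : reachable parent_graph x y <-> root_of x = root_of y.
Proof.
split=> [|rxy]; last first.
  apply: rt_trans (reachable_root x) _; rewrite rxy.
  exact/reachable_sym/reachable_root.
elim=> [a b /parent_adj[ab|ba]|//|a b c _ -> _ ->//].
  exact: root_parent.
exact/esym/root_parent.
Qed.

End ParentForest.

(** * Forests whose components are omega-trees *)

Lemma infinite_nat_enum (S : set nat) : infinite_set S ->
  exists f : nat -> nat, [/\ injective f, forall n, S (f n) &
    forall x, S x -> exists n, f n = x].
Proof.
move=> Sinf; have /card_esym/pcard_eqP/bijPex[f [fS finj fsurj]] :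
  S #= [set: nat] by exact: eq_card_nat.
exists f; split=> [m n|n|x Sx]; first by apply: finj; rewrite inE.
  exact: fS.
by have [n _ <-] := fsurj x Sx; exists n.
Qed.

Section OmegaForest.
Variable Z : Type.

Let odown (u v : Z * seq nat) := u.1 = v.1 /\ exists n, v.2 = n :: u.2.

Let oadj_sym u v : odown u v \/ odown v u -> odown v u \/ odown u v.
Proof. by case; [right|left]. Qed.

Let oadj_irr u : ~ (odown u u \/ odown u u).
Proof. by case=> -[_ [n /(congr1 size)/= /n_Sn]]. Qed.

(** The disjoint union of one omega-tree for each element of [Z]: the vertices
    of a tree are the finite words over [nat], the root is the empty word and
    the children of a word are its extensions by one letter. *)
Definition omega_forest : sgraph (Z * seq nat) := SGraph oadj_sym oadj_irr.

End OmegaForest.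

Section InfinitelyManyChildren.
Variable p : nat -> option nat.
Hypothesis p_lt : parent_decreases p.
Hypothesis p_inf : forall v, infinite_set [set i | p i = Some v].

(** Enumerate the children of each vertex by [nat]. A vertex is then coded by
    the root of its component and the word of the ranks, among siblings, on the
    path that leads to it. *)
Lemma parent_graph_omega_forest :
  iso (parent_graph p) (omega_forest {z : nat | p z = None}).
Proof.
have /choice[c cP] : forall v, exists f : nat -> nat,
    [/\ injective f, forall n, p (f n) = Some v &
      forall x, p x = Some v -> exists n, f n = x].
  by move=> v; exact: (infinite_nat_enum (@p_inf v)).
have cinj v : injective (c v) by case: (cP v).
have cchild v n : p (c v n) = Some v by case: (cP v) => _ + _; apply.
have csurj v x : p x = Some v -> exists n, c v n = x by case: (cP v) => _ _; apply.
pose Z := {z : nat | p z = None}.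
pose f (u : Z * seq nat) := foldr (fun n v => c v n) (sval u.1) u.2.
have f_cons z n s : f (z, n :: s) = c (f (z, s)) n by [].
have f_nil z : p (f (z, [::])) = None by exact: (svalP z).
have finj : injective f.
  move=> [z s] [z' s']; elim: s s' => [|n s ih] [|n' s'].
  - case: z z' => z zP [z' zP'] /= zz'; rewrite /f /= in zz'; subst z'.
    by rewrite (Prop_irrelevance zP zP').
  - by move/(congr1 p); rewrite f_nil f_cons cchild.
  - by move/(congr1 p); rewrite f_nil f_cons cchild.
  move=> e; have := congr1 p e; rewrite !f_cons !cchild => -[fss].
  have [? ?] := ih _ fss; subst z' s'.
  by move: e; rewrite !f_cons => /cinj ->.
have fsurj v : exists u, f u = v.
  elim/ltn_ind: v => v ih; case E: (p v) => [u|].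
    have [[z s] fu] := ih u (p_lt E); have [n cn] := csurj _ _ E.
    by exists (z, n :: s); rewrite f_cons fu.
  by exists (exist _ v E, [::]).
have fdown u v : p (f v) = Some (f u) <-> u.1 = v.1 /\ exists n, v.2 = n :: u.2.
  case: u v => z s [z' [|n s']] /=; first by rewrite f_nil; split=> // -[_ []].
  rewrite f_cons cchild; split=> [[/finj[-> ->]]|[-> [n' [_ ->]]]] //.
  by split=> //; exists n.
apply: iso_sym; exists f; split; first exact: inj_surj_bijective.
move=> u v; rewrite parent_adj // !fdown /=; tauto.
Qed.

End InfinitelyManyChildren.

Lemma reachable_iso (V W : Type) (G : sgraph V) (H : sgraph W) (f : V -> W) :
  bijective f -> (forall x y, adj G x y <-> adj H (f x) (f y)) ->
  forall x y, reachable G x y <-> reachable H (f x) (f y).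
Proof.
case=> g fK gK fadj x y; split; first by apply: reachable_map => a b /fadj.
move=> /(reachable_map (f := g)); rewrite !fK; apply=> a b ab.
by apply/fadj; rewrite !gK.
Qed.

(** A component contains all the neighbours of its vertices, so infinite degree,
    and with it infinite size, passes from the graph to its components. *)
Lemma component_omega_tree (V : Type) (G : sgraph V) :
  countable [set: V] -> acyclic G -> (forall v, infinite_set [set w | adj G v w]) ->
  forall C, components G C -> omega_tree (induced_subgraph G C).
Proof.
move=> Vc Gac Ginf C CG; have nbr (x : C) w : adj G (val x) w -> w \in C.
  case: CG x => v -> x xw; rewrite inE; apply: rt_trans (rt_step _ _ _ _ xw).
  by have := valP x; rewrite inE.
have deg (x : C) : infinite_set [set w | adj (induced_subgraph G C) x w].
  move=> fin; apply: (Ginf (val x)).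
  apply: sub_finite_set (finite_image val fin) => w xw.
  by exists (SigSub (nbr _ _ xw)).
have [v Cv] : exists v, C v by case: CG => v ->; exists v; exact: rt_refl.
have Cv' : v \in C by rewrite inE.
split=> //.
- split; first exact: (inhabits (SigSub Cv')).
    case: CG (nbr) => c Cc nbr' x y.
    apply: (reachable_pullback (f := val)) => [|z w zw|]; first exact: val_inj.
      by exists (SigSub (nbr' _ _ zw)).
    have inC w : C w -> reachable G c w by rewrite Cc.
    have [/set_mem/inC cx /set_mem/inC cy] := (valP x, valP y).
    exact: rt_trans (reachable_sym cx) cy.
  by apply: (acyclic_inj (H := G) (f := val)) => //; exact: val_inj.
- apply: eq_card_nat; last by apply: sub_infinite_set (deg (SigSub Cv')).
  have /countable_injP[f finj] := Vc.
  apply/countable_injP; exists (f \o val) => x y _ _ fxy.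
  by apply: val_inj; apply: finj => //; rewrite inE.
Qed.

Lemma card_components_parent_graph (p : nat -> option nat) (V : Type)
    (G : sgraph V) : parent_decreases p -> iso G (parent_graph p) ->
  components G #= [set z | p z = None].
Proof.
move=> p_lt /iso_sym[f [fbij fadj]]; have fr := reachable_iso fbij fadj.
pose F z := [set w | reachable G (f z) w].
have -> : components G = F @` [set z | p z = None].
  case: (fbij) => g fK gK; apply/seteqP; split=> [C [v ->]|C [z _ <-]]; last first.
    by exists (f z).
  exists (root_of p (g v)); first exact: rootP.
  have vr : reachable G v (f (root_of p (g v))).
    by rewrite -{1}(gK v); apply/fr; exact: reachable_root.
  rewrite /F; apply/seteqP; split=> w /=; first exact: rt_trans.
  exact/rt_trans/reachable_sym.
apply: inj_card_eq => z z' /set_mem/= z0 /set_mem/= z0' Fzz.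
have /fr/(reachableP p_lt) : F z (f z') by rewrite Fzz; exact: rt_refl.
by rewrite !root_id.
Qed.

(** * Finite trees and increasing labellings *)

(** The parent functions of recursive trees on [{0, ..., n - 1}]: every prefix
    is a subtree. *)
Definition tree_shape (n : nat) (q : nat -> option nat) :=
  forall j, (j < n)%N ->
    if j is 0 then q j = None else exists2 k, (k < j)%N & q j = Some k.

Lemma acyclic_no_cycle (V : eqType) (G : sgraph V) (s : seq V) :
  acyclic G -> uniq s -> (2 < size s)%N ->
  ~ cycle (fun x y => `[< adj G x y >]) s.
Proof.
case: s => [//|v s] Gac us s2 cs; apply: Gac.
exists (size s).+1, (fun i => nth v (v :: s) i); split=> //= [i j /eqP|i].
  by rewrite (nth_uniq v (s := v :: s)) //= ?ltn_ord // => /eqP/val_inj.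
have /(pathP v)/(_ i) := cs; rewrite size_rcons ltn_ord => /(_ isT)/asboolP.
have -> : nth v (v :: rcons s v) i = nth v (v :: s) i.
  by rewrite -rcons_cons nth_rcons ltn_ord.
suff -> : nth v (rcons s v) i = nth v (v :: s) (ordS i) by [].
rewrite nth_rcons /=; have [il|li|ie] := ltngtP i (size s).
- by rewrite modn_small.
- by have := ltn_ord i; lia.
- by rewrite ie modnn.
Qed.

Section TreeShape.
Variables (n : nat) (T : sgraph 'I_n).
Hypothesis treeT : tree T.

Let e x y := `[< adj T x y >].

Let spans (s : seq 'I_n) q := [/\ uniq s, tree_shape (size s) q &
  forall i j x, (i < size s)%N -> (j < size s)%N ->
    adj T (nth x s i) (nth x s j) <-> q i = Some j \/ q j = Some i].

Let spans_connect s q : spans s q -> forall x y, x \in s -> y \in s ->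
  connect (fun a b => [&& e a b, a \in s & b \in s]) x y.
Proof.
move=> [us sq sadj] x y xs ys; set r := (fun a b => _).
have rsym : connect_sym r.
  apply: sym_connect_sym => a b; apply/and3P/and3P.
    by case=> /asboolP ab ? ?; split=> //; exact/asboolP/adj_sym.
  by case=> /asboolP ab ? ?; split=> //; exact/asboolP/adj_sym.
suff to0 j : (j < size s)%N -> connect r (nth x s j) (nth x s 0).
  have := to0 (index x s); have := to0 (index y s).
  rewrite !index_mem !nth_index // => /(_ ys) y0 /(_ xs) x0.
  by apply: connect_trans x0 _; rewrite rsym.
elim/ltn_ind: j => -[|j] ih js; first exact: connect0.
have /= [k kj qj] := sq _ js; have ks : (k < size s)%N by exact: ltn_trans js.
apply: connect_trans (ih k kj ks); apply: connect1.
rewrite /r !mem_nth ?andbT //.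
by apply/asboolP/sadj => //; left.
Qed.

(** A new vertex has exactly one neighbour in a subtree: a path between two of
    them would close up to a cycle. *)
Let one_neighbour s q v x y : spans s q -> v \notin s -> x \in s -> y \in s ->
  adj T v x -> adj T v y -> x = y.
Proof.
move=> sq vs xs ys vx vy; apply/eqP/negPn/negP => xy.
have /connectP[t tp ty] := spans_connect sq xs ys.
case/shortenP: tp ty => t' tp tu _ ty.
have ts : {subset t' <= s}.
  move: tp {tu ty vx xy xs}; elim: t' x => [//|a t' ih] x /= /andP[/and3P[_ _ xs] tp].
  by move=> b; rewrite inE => /predU1P[->//|]; exact: ih tp _.
have [_ _ Tac] := treeT.
apply: (@acyclic_no_cycle _ T (v :: x :: t')) => //=.
- rewrite -/(uniq (x :: t')) tu andbT inE negb_or; apply/andP; split.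
    by apply: contraNneq vs => ->.
  by apply: contra vs; exact: ts.
- by case: t' {tp tu ts} ty => [/eqP|//]; rewrite eq_sym (negPf xy).
- apply/andP; split; first exact/asboolP.
  rewrite rcons_path -ty; apply/andP; split; last exact/asboolP/adj_sym.
  by apply: sub_path tp => a b /and3P[].
Qed.

Let spans_extend s q : spans s q -> (0 < size s < n)%N ->
  exists v q', spans (rcons s v) q'.
Proof.
move=> sq /andP[s0 sn]; have [us shq sadj] := sq; have [_ Tconn _] := treeT.
have [w ws] : exists w, w \notin s.
  apply/existsP; rewrite -negb_forall; apply/negP => /forallP sall.
  have : (#|'I_n| <= size s)%N 
    by rewrite -(card_uniqP us) subset_leq_card //; exact/fintype.subsetP.
  by rewrite card_ord leqNgt sn.
have [v [k [vs ks vk]]] : exists v k, [/\ v \notin s, (k < size s)%N &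
    adj T v (nth v s k)].
  have := Tconn (nth w s 0) w; have : nth w s 0 \in s by exact: mem_nth.
  move: (nth w s 0) => x xs /(@clos_rt_rtn1 _ _ _ _) xw.
  elim: xw ws => [|a b ab _ ih bs]; first by rewrite xs.
  have [as_|/ih//] := boolP (a \in s).
  exists b, (index a s); split=> //; first by rewrite index_mem.
  by rewrite nth_index //; exact: adj_sym.
exists v, (fun j => if j == size s then Some k else q j); split.
- by rewrite rcons_uniq vs.
- move=> j; rewrite size_rcons ltnS leq_eqVlt => /predU1P[->|js].
    by case: (size s) s0 ks => // m _ km; rewrite eqxx; exists k.
  by rewrite (ltn_eqF js); exact: shq.
have qlt i j : (i < size s)%N -> q i = Some j -> (j < i)%N.
  by move=> il; have := shq _ il; case: i il => [_ ->//|i il [k' k'i ->] [<-]].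
have new j x : (j < size s)%N -> adj T v (nth x s j) <-> k = j.
  move=> js; split=> [vj|<-]; last by rewrite (set_nth_default v).
  apply/eqP; rewrite -(nth_uniq x ks js us); apply/eqP.
  apply: (one_neighbour sq vs _ _ _ vj); rewrite ?mem_nth //.
  by rewrite (set_nth_default v).
move=> i j x; rewrite size_rcons !ltnS !nth_rcons.
rewrite (leq_eqVlt i) (leq_eqVlt j) => /predU1P[->|is_] /predU1P[->|js].
- rewrite ltnn eqxx; split=> [h|[] [kk]]; first by case: (adj_irr h).
    by rewrite kk ltnn in ks.
  by rewrite kk ltnn in ks.
- rewrite ltnn js eqxx (ltn_eqF js) new //; split=> [->|[[->]//|]]; first by left.
  by move/(qlt _ _ js); lia.
- rewrite ltnn is_ eqxx (ltn_eqF is_).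
  split=> [/(@adj_sym _ _ _ _) vi|[/(qlt _ _ is_)|[ki]]]; last 2 first.
  + by lia.
  + by apply: adj_sym; rewrite new.
  by right; rewrite (iffLR (new _ _ is_) vi).
- by rewrite is_ js (ltn_eqF is_) (ltn_eqF js); exact: sadj.
Qed.

(** A subtree can be enlarged by one leaf at a time: by connectedness some other
    vertex is adjacent to it, and to a single vertex of it. *)
Lemma tree_has_shape : exists q, tree_shape n q /\
  iso T (pullback (@nat_of_ord n) (parent_graph q)).
Proof.
have [[v0] _ _] := treeT; have n0 : (0 < n)%N by case: (n) v0 => [[]|].
have [s [q [sn sq]]] : exists s q, size s = n /\ spans s q.
  suff grow m : (0 < m <= n)%N -> exists s q, size s = m /\ spans s q.
    by apply: grow; rewrite n0 leqnn.
  elim: m => // -[_ _|m ih /andP[_ mn]].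
    exists [:: v0], (fun=> None); split=> //; split=> // [[]//|].
    move=> i j x; rewrite !ltnS !leqn0 => /eqP -> /eqP -> /=.
    by split=> [/(@adj_irr _ T v0)|[]].
  have [|s [q [sm sq]]] := ih; first by rewrite (ltnW mn).
  have [|v [q' vq']] := spans_extend sq; first by rewrite sm.
  by exists (rcons s v), q'; rewrite size_rcons sm.
have [us shq sadj] := sq; rewrite sn in shq.
have qlt i j : (i < n)%N -> q i = Some j -> (j < i)%N.
  by move=> il; have := shq _ il; case: i il => [_ ->//|i il [k' k'i ->] [<-]].
exists q; split=> //; apply: iso_sym.
pose f (j : 'I_n) := nth v0 s j.
have finj : injective f.
  by move=> i j /eqP; rewrite nth_uniq ?sn ?ltn_ord // => /eqP/val_inj.
exists f; split; first exact: injF_bij.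
move=> i j; rewrite sadj ?sn ?ltn_ord //= ; split=> -[]; [tauto|tauto| |].
  by move=> ij; left; split=> //; exact: (qlt _ _ (ltn_ord i)).
by move=> ij; right; split=> //; exact: (qlt _ _ (ltn_ord j)).
Qed.

End TreeShape.

(** * Occurrences of a tree shape in a forest *)

Section Occurrences.
Variable p : nat -> option nat.
Hypothesis p_lt : parent_decreases p.

(** Index [0] of a tree shape has no parent, so the list has to start with a
    root of the forest. *)
Definition embeds (q : nat -> option nat) (s : seq nat) :=
  forall j, (j < size s)%N -> p (nth 0%N s j) = omap (nth 0%N s) (q j).

Definition closed_under_children (s : seq nat) :=
  forall i a, a \in s -> p i = Some a -> i \in s.

(** An embedded shape that is closed under children is a whole component. *)
Definition occurs (q : nat -> option nat) (s : seq nat) :=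
  embeds q s /\ closed_under_children s.

Lemma embeds_root q s j : tree_shape (size s) q -> embeds q s ->
  (j < size s)%N -> root_of p (nth 0%N s j) = nth 0%N s 0.
Proof.
move=> shq eqs; elim/ltn_ind: j => -[|j] ih js; have := shq _ js.
  by move=> q0; apply: (root_id p_lt); rewrite eqs // q0.
move=> /= [k kj qj]; rewrite -(ih k kj (ltn_trans kj js)); apply: (root_parent p_lt).
by rewrite eqs // qj.
Qed.

Lemma mem_embeds_root q s w : tree_shape (size s) q -> embeds q s ->
  w \in s -> root_of p w = nth 0%N s 0.
Proof.
by move=> shq eqs ws; rewrite -(nth_index 0%N ws) (embeds_root shq eqs) // index_mem.
Qed.

Lemma occurs_component q s w : (0 < size s)%N -> tree_shape (size s) q ->
  occurs q s -> w \in s <-> root_of p w = nth 0%N s 0.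
Proof.
move=> s0 shq [eqs cs]; split; first exact: mem_embeds_root shq eqs.
elim/ltn_ind: w => w ih; rewrite rootE //; case E: (p w) => [u|].
  by move=> uw; exact: cs (ih u (p_lt E) uw) E.
by move=> ->; exact: mem_nth.
Qed.

(** Both lists enumerate components of the forest, in increasing order. *)
Lemma occurs_disjoint q s t : sorted ltn s -> sorted ltn t ->
  size s = size t -> tree_shape (size s) q -> occurs q s -> occurs q t ->
  has (mem s) t -> s = t.
Proof.
move=> ss st sst shq os ot /hasP[a at_ as_]; have {}as_ : a \in s by [].
have s0 : (0 < size s)%N by case: (s) as_.
have t0 : (0 < size t)%N by rewrite -sst.
have inS w := occurs_component w s0 shq os.
have inT w : w \in t <-> root_of p w = nth 0%N t 0.
  by apply: occurs_component ot; rewrite // -sst.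
have ra := iffLR (inS a) as_; have rb := iffLR (inT a) at_.
apply: (irr_sorted_eq ltn_trans ltnn ss st) => w.
by apply/idP/idP => [/inS|/inT] rw; [apply/inT|apply/inS]; congruence.
Qed.

Lemma embeds_adj q s i j : uniq s -> tree_shape (size s) q -> embeds q s ->
  (i < size s)%N -> (j < size s)%N ->
  adj (parent_graph p) (nth 0%N s i) (nth 0%N s j) <-> adj (parent_graph q) i j.
Proof.
move=> us shq eqs.
have down a b : (a < size s)%N -> (b < size s)%N ->
    p (nth 0%N s a) = Some (nth 0%N s b) <-> q a = Some b /\ (b < a)%N.
  move=> al bl; rewrite eqs //; have := shq a al.
  case: a al => [_ ->|a al [k ka ->]] /=; first by split=> // -[].
  split=> [[/eqP]|[[->]]//]; rewrite nth_uniq //; last exact: ltn_trans al.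
  by move=> /eqP <-.
by move=> il jl; rewrite parent_adj // !down //=.
Qed.

(** Whoever lies in a finite component has its parent there, so the increasing
    enumeration of a component embeds some tree shape, and so does each of its
    prefixes. *)
Lemma component_embeds (s : seq nat) (r : nat) : sorted ltn s ->
  (forall w, w \in s <-> root_of p w = r) ->
  forall m, exists q, tree_shape (size (take m s)) q /\ embeds q (take m s).
Proof.
move=> ss sr m; exists (fun j => omap (index^~ s) (p (nth 0%N s j))).
have us : uniq s by exact: (sorted_uniq ltn_trans ltnn).
have parent_before j u : (j < size s)%N -> p (nth 0%N s j) = Some u ->
    (index u s < j)%N /\ u \in s.
  move=> js ju; have us' : u \in s.
    apply/sr; rewrite -(root_parent p_lt ju); apply/sr; exact: mem_nth.
  split=> //; rewrite ltnNge; apply/negP => ju'; have := p_lt ju.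
  rewrite -{1}(nth_index 0%N us') ltnNge; apply/negP/negPn.
  rewrite (sorted_leq_nth leq_trans leqnn) ?inE ?index_mem //.
  by apply: sub_sorted ss => a b /ltnW.
have sz : (size (take m s) <= size s)%N by rewrite size_take_min geq_minr.
split=> j jm; have js := leq_trans jm sz.
  case: j jm js => [|j] jm js.
    by case E: (p _) => [u|] //; have [] := parent_before _ _ js E.
  case E: (p _) => [u|].
    by have [uj _] := parent_before _ _ js E; exists (index u s).
  have s0 : (0 < size s)%N by exact: leq_ltn_trans js.
  have /sr rj : nth 0%N s j.+1 \in s by exact: mem_nth.
  have /sr r0 : nth 0%N s 0 \in s by exact: mem_nth.
  have := root_le p_lt (nth 0%N s 0); rewrite r0 -rj root_id // leqNgt.
  by rewrite (sorted_ltn_nth ltn_trans) ?inE.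
rewrite nth_take; last first.
  by move: jm; rewrite size_take_min => /leq_trans; apply; exact: geq_minl.
case E: (p _) => [u|] //=; have [uj us'] := parent_before _ _ js E.
rewrite nth_take ?nth_index //; apply: ltn_trans uj _.
by move: jm; rewrite size_take_min => /leq_trans; apply; exact: geq_minl.
Qed.

End Occurrences.

(** * Assembling a forest with finite components *)

Lemma unbounded_infinite (S : set nat) :
  (forall N, exists2 x, (N <= x)%N & S x) -> infinite_set S.
Proof.
move=> Sunb /finite_seqP[s Ss]; have [x] := Sunb (\max_(y <- s) y).+1.
rewrite Ss /= => + xs; apply/negP; rewrite -ltnNge ltnS.
exact: (leq_bigmax_seq (F := id)).
Qed.

Lemma eq_tree_type n (c c' : tree_type n) :
  iso (representative c) (representative c') -> c = c'.
Proof.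
rewrite /representative; set U := cid _; set U' := cid _.
move: (svalP U) (svalP U'); move: (sval U) (sval U') => {U} U {}U'.
case: c c' => C CP [C' C'P] /= CU CU' UU'.
suff CC : C = C' by subst C'; rewrite (Prop_irrelevance CP C'P).
have [[T CT] [T' CT']] := (CP, C'P).
rewrite CT /= in CU; rewrite CT' /= in CU'.
have TT : iso (sval T) (sval T').
  exact: iso_trans CU (iso_trans UU' (iso_sym CU')).
rewrite CT CT'; apply/seteqP; split=> V /= h; first exact: iso_trans (iso_sym TT) h.
exact: iso_trans TT h.
Qed.

Lemma tree_type_of n (T : sgraph 'I_n) : tree T ->
  exists c : tree_type n, iso T (representative c).
Proof.
move=> treeT; pose L : labelled_tree n := exist _ T treeT.
pose C := [set U : labelled_tree n | iso (sval L) (sval U)].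
have CP : exists T0 : labelled_tree n,
  C = [set U : labelled_tree n | iso (sval T0) (sval U)] by exists L.
pose c : tree_type n := exist _ C CP.
by exists c; exact: svalP (cid (tree_type_inhabited c)).
Qed.

Section Assembly.
Variables (p : nat -> option nat) (k : option nat).
Hypothesis p_lt : parent_decreases p.

Let G := parent_graph p.

Definition component v : {fset nat} := fset_set [set w | root_of p w = root_of p v].

Hypothesis fin_component : forall v, finite_set [set w | root_of p w = root_of p v].

Lemma in_component v w : (w \in component v) = (root_of p w == root_of p v).
Proof. by rewrite in_fset_set //; apply/idP/eqP; rewrite inE. Qed.

Hypothesis shapes_occur : forall i q N, (0 < i)%N -> lt_or_infinity i k ->
  tree_shape i q -> exists s, [/\ sorted ltn s, size s = i,
    (N <= nth 0 s 0)%N & occurs p q s].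

Let copy n (T : sgraph 'I_n) (f : 'I_n -> nat) := [/\ injective f,
  forall x y, adj T x y <-> adj G (f x) (f y),
  forall x y, root_of p (f x) = root_of p (f y) &
  forall x w, root_of p w = root_of p (f x) -> exists y, f y = w].

Let copy_size n (T : sgraph 'I_n) f x : copy T f -> #|` component (f x)| = n.
Proof.
case=> finj _ fr fsurj.
have -> : component (f x) = [fset f y | y in 'I_n]%fset; last first.
  by rewrite card_imfset //= -cardE card_ord.
apply/fsetP => w; rewrite in_component; apply/eqP/imfsetP => [/fsurj[y <-]|[y _ ->]].
  by exists y.
exact: fr.
Qed.

Let copies_iso n (T T' : sgraph 'I_n) f f' x x' : copy T f -> copy T' f' ->
  root_of p (f x) = root_of p (f' x') -> iso T T'.
Proof.
case=> finj fadj fr fsurj [f'inj f'adj f'r f'surj] xx'.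
have /choice[g gP] : forall y, exists z, f' z = f y.
  by move=> y; apply: (f'surj x'); rewrite -xx'; exact: fr.
have ginj : injective g by move=> y z yz; apply: finj; rewrite -!gP yz.
exists g; split; first exact: injF_bij.
by move=> y z; rewrite fadj f'adj !gP.
Qed.

Let enumerate_copies n (T : sgraph 'I_n) : tree T -> lt_or_infinity n k ->
  exists F : nat -> 'I_n -> nat, [/\ forall m, copy T (F m),
    forall m m' x x', root_of p (F m x) = root_of p (F m' x') -> m = m' &
    forall f x, copy T f -> exists m y, F m y = f x].
Proof.
move=> treeT nk; have [[x0] _ _] := treeT.
have n0 : (0 < n)%N by case: (n) x0 => [[]|].
have [q [shq [g [gbij gadj]]]] := tree_has_shape treeT.
pose S := [set r | exists f, copy T f /\ root_of p (f x0) = r].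
have Sinf : infinite_set S.
  apply: unbounded_infinite => N.
  have [s [ss sn sN [eqs cs]]] := shapes_occur N n0 nk shq; rewrite -sn in shq n0.
  have us : uniq s by exact: (sorted_uniq ltn_trans ltnn).
  have inS w := occurs_component p_lt w n0 shq (conj eqs cs).
  have gs x : (g x < size s)%N by rewrite sn.
  have rs x : root_of p (nth 0%N s (g x)) = nth 0%N s 0.
    by apply/inS; exact: mem_nth.
  exists (nth 0%N s 0) => //; exists (fun x => nth 0%N s (g x)); split=> //; split.
  - by move=> x y /eqP; rewrite nth_uniq // => /eqP/val_inj/(bij_inj gbij).
  - by move=> x y; rewrite gadj (embeds_adj p_lt us shq eqs).
  - by move=> x y; rewrite !rs.
  move=> x w; rewrite rs => /inS ws; case: gbij => g' _ g'K.
  have il : (index w s < n)%N by rewrite -sn index_mem.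
  by exists (g' (Ordinal il)); rewrite g'K /= nth_index.
have [e [einj eS esurj]] := infinite_nat_enum Sinf.
have /choice[F FP] := eS; exists F; split=> [m|m m' x x' xx'|f x fc].
- by case: (FP m).
- have [[[_ _ r _] rm] [[_ _ r' _] rm']] := (FP m, FP m').
  by apply: einj; rewrite -rm -rm' (r x0 x) xx'; exact: r'.
have [m em] : exists m, e m = root_of p (f x).
  by apply: esurj; exists f; split=> //; case: fc => _ _ r _; exact: r.
have [[_ _ _ surj] rm] := FP m; have [y yx] := surj x0 (f x) (etrans (esym em) (esym rm)).
by exists m, y.
Qed.

Let representative_tree n (c : tree_type n) : tree (representative c).
Proof. exact: svalP. Qed.

Variable big : {fset nat}.
Hypothesis bigP : forall v,
  v \in big <-> ~ lt_or_infinity #|` component v| k.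

Let I := {i : nat | (1 <= i)%N /\ lt_or_infinity i k}.

Let F (i : I) (c : tree_type (sval i)) : nat -> 'I_(sval i) -> nat :=
  sval (cid (enumerate_copies (representative_tree c) (svalP i).2)).

Let F_copy i c m : copy (representative c) (@F i c m).
Proof. by rewrite /F; case: cid => f [/= + _ _]; apply. Qed.

Let F_root i c m m' x x' : root_of p (@F i c m x) = root_of p (@F i c m' x') -> m = m'.
Proof. by rewrite /F; case: cid => f [/= _ + _]; apply. Qed.

Let F_surj i c f x : copy (representative c) f -> exists m y, @F i c m y = f x.
Proof. by rewrite /F; case: cid => g [/= _ _]; apply. Qed.

Let block := {i : I & {c : tree_type (sval i) & {_ : nat & 'I_(sval i)}}}.

Let place (u : block) : nat :=
  let: existT i (existT c (existT m x)) := u in @F i c m x.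

Let place_root u u' : root_of p (place u) = root_of p (place u') ->
  exists i c m x x', u = existT _ i (existT _ c (existT _ m x)) /\
    u' = existT _ i (existT _ c (existT _ m x')).
Proof.
case: u => i [c [m x]]; case: u' => i' [c' [m' x']] /= uu'.
have ii : sval i = sval i'.
  rewrite -(copy_size x (F_copy c m)) -(copy_size x' (F_copy c' m')).
  by congr #|` _|; apply/fsetP => w; rewrite !in_component uu'.
have {}ii : i = i'.
  case: i i' ii {c m x c' m' x' uu'} => i iP [i' iP'] /= ii; subst i'.
  by rewrite (Prop_irrelevance iP iP').
subst i'; have cc : c = c'.
  exact/eq_tree_type/(copies_iso (F_copy c m) (F_copy c' m') uu').
by subst c'; have ? := F_root uu'; subst m'; exists i, c, m, x, x'.
Qed.

Let place_small u : place u \notin big.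
Proof.
apply/negP => /bigP; case: u => i [c [m x]] /=; apply.
by rewrite (copy_size x (F_copy c m)); exact: (svalP i).2.
Qed.

Let place_adj u u' : adj (F_below k) u u' <-> adj G (place u) (place u').
Proof.
split=> [h|].
  inversion h as [i a b h1]; subst; inversion h1 as [c a' b' h2]; subst.
  inversion h2 as [m x y h3]; subst.
  by have [_ /(_ x y)[h4 _] _ _] := F_copy c m; exact: h4.
move=> h; have r : root_of p (place u) = root_of p (place u').
  by apply/reachableP => //; exact: rt_step.
have [i [c [m [x [x' [uE u'E]]]]]] := place_root r.
move: h; rewrite uE u'E /= => h; do 3!constructor.
by have [_ /(_ x x')[_ h4] _ _] := F_copy c m; exact: h4.
Qed.

Let big_adj x y : adj G x y -> x \in big -> y \in big.
Proof.
move=> xy /bigP xb; apply/bigP.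
have /reachableP-/(_ p_lt) r : reachable G x y by exact: rt_step.
suff -> : component y = component x by [].
by apply/fsetP => w; rewrite !in_component r.
Qed.

(** Sort the components by the tree that they are. For each tree with fewer than
    [k] vertices, its copies among the components are indexed by [nat], and a
    choice of isomorphisms with the representative of the tree places
    [F_below k] in the forest. The vertices that remain are those of [big]. *)
Lemma parent_graph_F_below :
  iso G (gsum (pullback (fun v : big => val v) G) (F_below k)).
Proof.
pose h (u : big + block) := match u with inl v => val v | inr u => place u end.
apply: iso_sym; exists h; split.
  apply: inj_surj_bijective.
    move=> [v|u] [v'|u'] /=; first by move/val_inj->.
    - by move=> vu; have := place_small u'; rewrite -vu (valP v).
    - by move=> uv; have := place_small u; rewrite uv (valP v').
    move=> uu'; have [|i [c [m [x [x' [uE u'E]]]]]] := @place_root u u'.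
      by rewrite uu'.
    move: uu'; rewrite uE u'E /=; have [finj _ _ _] := F_copy c m.
    by move/finj->.
  move=> v; have [vb|/negP vb] := boolP (v \in big); first by exists (inl [` vb]%fset).
  have vk : lt_or_infinity #|` component v| k by apply: contrapT; rewrite -bigP.
  set n := #|` component v| in vk; have n0 : (0 < n)%N.
    by rewrite cardfs_gt0; apply/fset0Pn; exists v; rewrite in_component.
  pose f (j : 'I_n) := nth 0%N (component v) j.
  have fC j : f j \in component v by exact: mem_nth.
  have fr j : root_of p (f j) = root_of p v by apply/eqP; rewrite -in_component.
  have finj : injective f.
    by move=> x y /eqP; rewrite nth_uniq ?fset_uniq ?ltn_ord // => /eqP/val_inj.
  have fsurj w : root_of p w = root_of p v -> exists y, f y = w.
    move=> /eqP; rewrite -in_component => wv.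
    have il : (index w (component v) < n)%N by rewrite index_mem.
    by exists (Ordinal il); rewrite /f /= nth_index.
  have [x fx] := fsurj v erefl.
  have treeT : tree (pullback f G).
    split; first exact: (inhabits x).
      move=> y z; apply: reachable_pullback => // [a w aw|].
        apply: fsurj; rewrite -(fr a); apply/reachableP => //.
        exact/reachable_sym/rt_step.
      by apply/reachableP; rewrite ?fr.
    by apply: (acyclic_inj (H := G) (f := f)) => //; exact: parent_graph_acyclic.
  have [c cT] := tree_type_of treeT; have [g [gbij gadj]] := iso_sym cT.
  have fgc : copy (representative c) (f \o g).
    split=> [|y z|y z|y w] /=; first exact: inj_comp (bij_inj gbij).
    - by rewrite gadj.
    - by rewrite !fr.
    rewrite fr => /fsurj[z <-]; case: gbij => g' _ g'K.
    by exists (g' z); rewrite g'K.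
  case: (gbij) => g' _ g'K.
  pose i : I := exist _ n (conj n0 vk).
  have [m [y my]] := @F_surj i c _ (g' x) fgc.
  by exists (inr (existT _ i (existT _ c (existT _ m y)))); rewrite /= my /= g'K.
move=> [v|u] [v'|u'] /=.
- by split=> [h1|]; [inversion h1|constructor].
- split=> [h1|vu]; first by inversion h1.
  by have := place_small u'; rewrite (big_adj vu) // (valP v).
- split=> [h1|uv]; first by inversion h1.
  by have := place_small u; rewrite (big_adj (adj_sym (uv : adj G _ _))) // (valP v').
by split=> [h1|/place_adj h1]; [inversion h1; subst; exact/place_adj|constructor].
Qed.

End Assembly.

(** * Elementary symmetric sums over sublists *)

Fixpoint sublists (m : nat) (s : seq nat) : seq (seq nat) :=
  match m, s with
  | 0, _ => [:: [::]]
  | _.+1, [::] => [::]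
  | m'.+1, a :: s' => map (cons a) (sublists m' s') ++ sublists m s'
  end.

Lemma sublists0 s : sublists 0 s = [:: [::]].
Proof. by case: s. Qed.

Lemma mem_sublists m s a :
  (a \in sublists m s) = subseq a s && (size a == m).
Proof.
elim: s m a => [|b s ih] [|m] a; rewrite ?sublists0 ?inE ?subseq0 //=.
- by case: a.
- by case: a.
- by case: a => //= c a; rewrite andbF.
rewrite mem_cat ih; apply/idP/idP.
  case/orP=> [/mapP[c + ->]|/andP[a_s am]].
    by rewrite ih /= eqxx eqSS.
  rewrite am andbT; case: a a_s {am} => // c a; case: ifP => // _.
  exact: cons_subseq.
case: a => [|c a]; first by rewrite andbF.
case: ifP => [/eqP -> /andP[a_s am]|_ /= ->]; last by rewrite orbT.
by apply/orP; left; apply/map_f; rewrite ih a_s.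
Qed.

Lemma uniq_sublists m s : uniq s -> uniq (sublists m s).
Proof.
elim: s m => [|b s ih] [|m] //= /andP[bs us].
rewrite cat_uniq map_inj_uniq ?ih //; last by move=> c c' [].
rewrite andbT; apply/hasPn => a; rewrite mem_sublists => /andP[a_s _].
by apply/mapP => -[c _ ac]; rewrite (mem_subseq a_s) // ac mem_head in bs.
Qed.

Lemma mem_sublists_iota m a b s : (s \in sublists m (index_iota a b)) =
  [&& sorted ltn s, size s == m & all (fun i => a <= i < b)%N s].
Proof.
rewrite mem_sublists andbC andbCA; congr (_ && _).
have si : sorted ltn (index_iota a b) by exact: iota_ltn_sorted.
apply/idP/andP => [s_i|[ss /allP s_ab]].
  split; first exact: subseq_sorted ltn_trans _ _ s_i si.
  by apply/allP => i /(mem_subseq s_i); rewrite mem_index_iota.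
suff -> : s = [seq i <- index_iota a b | i \in s] by exact: filter_subseq.
apply: (irr_sorted_eq ltn_trans ltnn ss).
  exact: sorted_filter ltn_trans _ _ si.
move=> i; rewrite mem_filter mem_index_iota /=; apply/idP/andP => [is_|[]//].
by split=> //; exact: s_ab.
Qed.

Lemma big_sublists_iota (R : nmodType) m a b (F : seq nat -> R) :
  \sum_(s <- sublists m.+1 (index_iota a b)) F s =
  \sum_(a <= i < b) \sum_(s <- sublists m (index_iota i.+1 b)) F (i :: s).
Proof.
have [ba|ab] := leqP b a.
  by rewrite big_geq // (_ : index_iota a b = [::]) ?big_nil // /index_iota (eqP ba).
rewrite -(subKn (ltnW ab)); move: (b - a)%N (leq_subr a b) => n.
elim: n => [|n ih] nb; first by rewrite subn0 big_geq // /index_iota subnn big_nil.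
rewrite big_ltn ?ltn_subrL //; last by lia.
have -> : index_iota (b - n.+1) b = (b - n.+1)%N :: index_iota (b - n) b.
  rewrite /index_iota subKn // (_ : b - (b - n) = n)%N /=; last by lia.
  by congr (_ :: iota _ _); lia.
rewrite /= big_cat big_map ih; last exact: ltnW.
by rewrite (_ : (b - n.+1).+1 = b - n)%N //; lia.
Qed.

Section SymmetricSums.
Variables (R : realType) (x : nat -> R).

(** The elementary symmetric polynomial of degree [m] in the [x i], [i] in [s]. *)
Definition esymm (m : nat) (s : seq nat) : R :=
  \sum_(a <- sublists m s) \prod_(i <- a) x i.

Lemma esymm0 s : esymm 0 s = 1.
Proof. by rewrite /esymm sublists0 big_seq1 big_nil. Qed.

Lemma esymm_nil m : esymm m.+1 [::] = 0.
Proof. by rewrite /esymm big_nil. Qed.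

Lemma esymm_cons m b s : esymm m.+1 (b :: s) = x b * esymm m s + esymm m.+1 s.
Proof.
rewrite /esymm /= big_cat big_map; congr (_ + _); rewrite mulr_sumr.
by apply: eq_bigr => a _; rewrite big_cons.
Qed.

Lemma esymm_iota m a b :
  esymm m.+1 (index_iota a b) = \sum_(a <= i < b) x i * esymm m (index_iota i.+1 b).
Proof.
rewrite /esymm big_sublists_iota; apply: eq_bigr => i _.
by rewrite mulr_sumr; apply: eq_bigr => s _; rewrite big_cons.
Qed.

Hypothesis x0 : forall i, 0 <= x i.

Lemma esymm_ge0 m s : 0 <= esymm m s.
Proof. by apply: sumr_ge0 => a _; exact: prodr_ge0. Qed.

(** Multiplying [e_m] by [e_1] counts every monomial of [e_(m+1)] exactly
    [m + 1] times; the other monomials contain a square, and each of them is at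
    most [a] times a monomial of [e_m]. *)
Lemma esymm_mul_le m s : m.+1%:R * esymm m.+1 s <= (\sum_(i <- s) x i) * esymm m s.
Proof.
elim: s m => [|b s ih] m; first by rewrite esymm_nil big_nil mulr0 mul0r.
rewrite big_cons esymm_cons; case: m => [|m].
  rewrite !esymm0 !mulr1 mul1r lerD2l.
  by have := ih 0%N; rewrite esymm0 mulr1 mul1r.
rewrite esymm_cons; have := ih m; have := ih m.+1.
have := x0 b; have := esymm_ge0 m s; have := esymm_ge0 m.+1 s.
move: (esymm m.+2 s) (esymm m.+1 s) (esymm m s) (\sum_(i <- s) x i) (x b).
move=> e2 e1 e0 S y e1_ge0 e0_ge0 y_ge0 h1 h2.
rewrite -(natr1 m.+1) -(natr1 m) in h1 h2 *.
have := ler_wpM2l y_ge0 h2; have : 0 <= y * y * e0 by rewrite !mulr_ge0.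
by lra.
Qed.

Lemma esymm_mul_ge a m s : (forall i, i \in s -> x i <= a) ->
  (\sum_(i <- s) x i) * esymm m s <=
  m.+1%:R * esymm m.+1 s + m%:R * a * esymm m s.
Proof.
elim: s m => [|b s ih] m xa; first by rewrite esymm_nil big_nil mulr0 mul0r add0r;
  case: m => [|m]; rewrite ?esymm_nil ?mulr0 ?mul0r.
have {}ih k := ih k (fun i is_ => xa i (mem_behead (s := b :: s) is_)).
have {}xa : x b <= a by apply: xa; rewrite mem_head.
rewrite big_cons esymm_cons; case: m => [|m].
  rewrite !esymm0 !mulr1 !mul0r addr0 mul1r lerD2l.
  by have := ih 0%N; rewrite esymm0 mulr1 mul1r !mul0r addr0.
rewrite esymm_cons; have := ih m; have := ih m.+1.
have := x0 b; have := esymm_ge0 m s.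
move: (esymm m.+2 s) (esymm m.+1 s) (esymm m s) (\sum_(i <- s) x i) (x b) xa.
move=> e2 e1 e0 S y ya e0_ge0 y_ge0 h1 h2.
rewrite -(natr1 m.+1) -(natr1 m) in h1 h2 *.
have := ler_wpM2l y_ge0 h2.
have : 0 <= (a - y) * (y * e0) by rewrite !mulr_ge0 // subr_ge0.
by lra.
Qed.

Lemma esymm_le_expr m s : esymm m s <= (\sum_(i <- s) x i) ^+ m.
Proof.
have S0 : 0 <= \sum_(i <- s) x i by exact: sumr_ge0.
elim: m => [|m ih]; first by rewrite esymm0 expr0.
rewrite exprS; apply: le_trans (ler_wpM2l S0 ih).
apply: le_trans (esymm_mul_le m s); rewrite ler_peMl ?esymm_ge0 //.
by rewrite ler1n.
Qed.

(** Iterate the preceding bound: the monomials with a square lost at each step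
    add up to [0 + 1 + ... + (m - 1)], which is ['C(m, 2)]. *)
Lemma expr_le_esymm a m s : 0 <= a -> (forall i, i \in s -> x i <= a) ->
  (\sum_(i <- s) x i) ^+ m <=
  m`!%:R * esymm m s + 'C(m, 2)%:R * a * (\sum_(i <- s) x i) ^+ m.-1.
Proof.
move=> a0 xa; set S := \sum_(i <- s) x i; have S0 : 0 <= S by exact: sumr_ge0.
elim: m => [|m ih]; first by rewrite esymm0 expr0 fact0 mul1r !mul0r addr0.
have := esymm_mul_ge m xa; rewrite -/S => h.
have := ler_wpM2l S0 ih; rewrite -exprS => /le_trans; apply.
have e : 'C(m, 2)%:R * (S * S ^+ m.-1) = 'C(m, 2)%:R * S ^+ m :> R.
  by case: m {ih h} => [|m]; [rewrite !mul0r|rewrite -exprS].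
have f0 : 0 <= m`!%:R :> R by [].
have := ler_wpM2l f0 h; rewrite [m.+1.-1]/= binS bin1 natrD factS natrM => h'.
have fe : m`!%:R * esymm m s <= S ^+ m.
  elim: m {ih h e f0 h'} => [|m ih]; first by rewrite esymm0 expr0 fact0 mul1r.
  rewrite exprS; apply: le_trans (ler_wpM2l S0 ih); rewrite mulrCA factS natrM.
  rewrite [_ * m`!%:R]mulrC -mulrA.
  by apply: ler_wpM2l => //; exact: esymm_mul_le.
have := ler_wpM2l (mulr_ge0 (ler0n _ m) a0) fe => fe'.
have -> : S * (m`!%:R * esymm m s + 'C(m, 2)%:R * a * S ^+ m.-1) =
    m`!%:R * (S * esymm m s) + a * ('C(m, 2)%:R * (S * S ^+ m.-1)) by ring.
rewrite e; lra.
Qed.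

(** The product expands into the sum of all the elementary symmetric sums. *)
Lemma sum_esymm_le n s : \sum_(0 <= m < n) esymm m s <= \prod_(i <- s) (1 + x i).
Proof.
elim: s n => [|b s ih] n.
  case: n => [|n]; first by rewrite big_geq // big_nil.
  rewrite big_nil big_nat_recl // esymm0 big1 ?addr0 // => m _.
  exact: esymm_nil.
case: n => [|n].
  by rewrite big_geq // prodr_ge0 // => i _; rewrite addr_ge0.
rewrite big_nat_recl // esymm0 big_cons mulrDl mul1r.
under eq_bigr do rewrite esymm_cons.
rewrite big_split /= -mulr_sumr addrCA addrC; apply: lerD.
  by have := ih n.+1; rewrite big_nat_recl // esymm0.
exact: ler_wpM2l.
Qed.

Lemma prod_1D_le_expR s : \prod_(i <- s) (1 + x i) <= expR (\sum_(i <- s) x i).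
Proof.
rewrite expR_sum; apply: ler_prod => i _.
by rewrite addr_ge0 // expR_ge1Dx.
Qed.

End SymmetricSums.

(** * Nonnegative series *)

Section NonnegativeSeries.
Variables (R : realType) (f : nat -> R).
Hypothesis f0 : forall i, 0 <= f i.
Implicit Types m M : nat.

Let fE0 m n : (m <= n)%N -> xpredT n -> (0 <= (f n)%:E)%E.
Proof. by rewrite lee_fin f0. Qed.

Lemma ler_sum_nat_widen m M M' : (M <= M')%N ->
  \sum_(m <= i < M) f i <= \sum_(m <= i < M') f i.
Proof.
move=> MM'; have [mM|Mm] := leqP m M; last first.
  by rewrite [leLHS]big_geq ?sumr_ge0 // ltnW.
by rewrite (big_cat_nat mM MM') /= lerDl sumr_ge0.
Qed.

Lemma divergent_series_ge m : (\sum_(m <= i <oo) (f i)%:E = +oo)%E ->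
  forall K, exists M, K <= \sum_(m <= i < M) f i.
Proof.
move=> foo K; apply: contrapT => /forallNP small.
suff : (\sum_(m <= i <oo) (f i)%:E <= K%:E)%E by rewrite foo leye_eq.
apply: lime_le; first by apply: is_cvg_nneseries => n mn _; exact: fE0 mn _.
by apply: nearW => M; rewrite sumEFin lee_fin ltW // ltNge; exact/negP.
Qed.

Lemma bounded_series_lty m K : (forall M, \sum_(m <= i < M) f i <= K) ->
  (\sum_(m <= i <oo) (f i)%:E < +oo)%E.
Proof.
move=> fK; apply: (@le_lt_trans _ _ K%:E); last exact: ltry.
apply: lime_le; first by apply: is_cvg_nneseries => n mn _; exact: fE0 mn _.
by apply: nearW => M; rewrite sumEFin lee_fin.
Qed.

Hypothesis f_lty : (\sum_(0 <= i <oo) (f i)%:E < +oo)%E.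

Lemma tail_series_fin m :
  (\sum_(m <= i <oo) (f i)%:E)%E = (fine (\sum_(m <= i <oo) (f i)%:E)%E)%:E.
Proof.
rewrite fineK // ge0_fin_numE; last exact: (nneseries_ge0 (@fE0 m)).
apply: le_lt_trans f_lty; rewrite (nneseries_split 0 m) ?add0n; last first.
  by move=> k _; rewrite lee_fin.
by rewrite leeDr // sumEFin lee_fin sumr_ge0.
Qed.

Lemma partial_le_tail m M :
  \sum_(m <= i < M) f i <= fine (\sum_(m <= i <oo) (f i)%:E)%E.
Proof.
rewrite -lee_fin -tail_series_fin -sumEFin.
exact: (nneseries_lim_ge M (@fE0 m)).
Qed.

Lemma cvg_partial_tail m :
  \sum_(m <= i < M) f i @[M --> \oo] --> fine (\sum_(m <= i <oo) (f i)%:E)%E.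
Proof.
apply: (@fine_cvg _ _ _ _ (fun M => (\sum_(m <= i < M) f i)%:E)).
rewrite -tail_series_fin; under eq_fun do rewrite -sumEFin.
by apply: is_cvg_nneseries => n mn _; exact: fE0 mn _.
Qed.

Lemma tail_series_cvg0 : fine (\sum_(m <= i <oo) (f i)%:E)%E @[m --> \oo] --> 0.
Proof.
apply: (@fine_cvg _ _ _ _ _ 0).
by apply: nneseries_tail_cvg => // k _; rewrite lee_fin.
Qed.

End NonnegativeSeries.

(** * The expected number of components of a given shape *)

Lemma exchange_big_triangle (R : nmodType) N M (F : nat -> nat -> R) :
  \sum_(N <= r < M) \sum_(r.+1 <= l < M) F r l =
  \sum_(N <= l < M) \sum_(N <= r < l) F r l.
Proof.
elim: M => [|M ih]; first by rewrite !big_geq.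
have [NM|MN] := leqP N M; last by rewrite !big_geq.
rewrite [LHS]big_nat_recr //= [RHS]big_nat_recr //= -ih.
rewrite (big_geq (leqnn M.+1)) addr0 -big_split /=.
by apply: eq_big_nat => r /andP[_ rM]; rewrite big_nat_recr.
Qed.

Section Rates.
Variables (R : realType) (d : nat -> nat).
Hypothesis d01 : forall n, d n = 0%N \/ d n = 1%N.

(** The probability that round [i] joins [v_i] to a given earlier vertex. *)
Definition rate (i : nat) : R := (d i)%:R / i%:R.

Local Notation x := rate.

Lemma rate_ge0 i : 0 <= x i.
Proof. by rewrite /rate divr_ge0. Qed.

Lemma rate0 : x 0 = 0.
Proof. by rewrite /rate invr0 mulr0. Qed.

Lemma rate_mul i : (0 < i)%N -> i%:R * x i = (d i)%:R.
Proof. by move=> i0; rewrite /rate mulrC divfK // pnatr_eq0 -lt0n. Qed.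

Lemma rate_le l i : (0 < l)%N -> (l < i)%N -> x i <= l%:R^-1.
Proof.
move=> l0 li; rewrite /rate; case: (d01 i) => ->; first by rewrite mul0r invr_ge0.
by rewrite mul1r lef_pV2 ?posrE ?ltr0n ?ler_nat; lia.
Qed.

Let zero r : R := (d r == 0%N)%:R.

Let zeroE r : zero r = 1 - (d r)%:R.
Proof. by rewrite /zero; case: (d01 r) => ->; rewrite ?subr0 ?subrr. Qed.

(** The probability that the vertices of [s] receive parents as prescribed by a
    fixed tree shape. *)
Definition shape_weight (s : seq nat) : R :=
  if s is r :: s' then (d r == 0%N)%:R * \prod_(i <- s') x i else 1.

Lemma shape_weight_ge0 s : 0 <= shape_weight s.
Proof.
case: s => [|r s] //=; rewrite mulr_ge0 // prodr_ge0 // => i _.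
exact: rate_ge0.
Qed.

Definition total_weight n N M : R :=
  \sum_(s <- sublists n (index_iota N M)) shape_weight s.

Let total_weightE n N M : total_weight n.+1 N M =
  \sum_(N <= r < M) zero r * esymm x n (index_iota r.+1 M).
Proof.
rewrite /total_weight big_sublists_iota; apply: eq_bigr => r _.
by rewrite -mulr_sumr.
Qed.

Let total_weight2E m N M : total_weight m.+2 N M =
  \sum_(N <= l < M) (\sum_(N <= r < l) zero r) * x l * esymm x m (index_iota l.+1 M).
Proof.
rewrite total_weightE.
under eq_bigr do rewrite esymm_iota mulr_sumr.
rewrite exchange_big_triangle; apply: eq_bigr => l _.
by rewrite -mulrA mulr_suml.
Qed.

Hypothesis x_lty : (\sum_(0 <= i <oo) (x i)%:E < +oo)%E.

Let t n : R := fine (tail R d n).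

Lemma tailE n : tail R d n = (t n)%:E.
Proof. by apply: tail_series_fin => // i; exact: rate_ge0. Qed.

Lemma rate_sum_le n M : \sum_(n <= i < M) x i <= t n.
Proof. by apply: partial_le_tail => // i; exact: rate_ge0. Qed.

Lemma fine_tail_ge0 n : 0 <= t n.
Proof.
by apply: le_trans (rate_sum_le n 0); rewrite sumr_ge0 // => i _; exact: rate_ge0.
Qed.

Lemma fine_tail_le m n : (m <= n)%N -> t n <= t m.
Proof.
move=> mn; rewrite -lee_fin -!tailE /tail.
rewrite (@nneseries_split _ _ m (n - m)); last first.
  by move=> i _; rewrite lee_fin; exact: rate_ge0.
by rewrite subnKC // leeDr // sumEFin lee_fin sumr_ge0.
Qed.

Lemma fine_tail_cvg0 : t n @[n --> \oo] --> 0.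
Proof. by apply: tail_series_cvg0 => // i; exact: rate_ge0. Qed.

(** Since [d i <= l * x i] for [i < l], the proportion of ones among the first
    [l] terms of [d] tends to zero. *)
Lemma many_zeroes N : exists2 N0, (0 < N0)%N && (N <= N0)%N &
  forall l, (N0 <= l)%N -> l%:R / 2 <= \sum_(N <= r < l) zero r.
Proof.
have [L L0 tL] : exists2 L, (0 < L)%N & t L <= 1 / 4.
  have /cvgrPdist_lt/(_ (1 / 4)) := fine_tail_cvg0.
  case=> [|L _ tL]; first by lra.
  exists L.+1 => //; have := tL L.+1 (leqnSn L).
  by rewrite sub0r normrN ger0_norm ?fine_tail_ge0 // => /ltW.
exists (4 * (N + L))%N; first by lia.
move=> l lN; under eq_bigr do rewrite zeroE.
have lN' : (4 : R) * (N%:R + L%:R) <= l%:R.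
  by rewrite -natrD -natrM ler_nat.
rewrite sumrB sumr_const_nat natrB; last by lia.
have le1 : \sum_(N <= r < l) ((d r)%:R : R) <= L%:R + l%:R * (1 / 4).
  apply: (@le_trans _ _ (\sum_(0 <= r < l) (d r)%:R)).
    rewrite (@big_cat_nat _ _ _ N 0 l) //=; last by lia.
    by rewrite lerDr sumr_ge0.
  rewrite (@big_cat_nat _ _ _ L 0 l) //=; last by lia.
  apply: lerD.
    apply: le_trans (_ : \sum_(0 <= r < L) 1 <= _); last by rewrite sumr_const_nat subn0.
    by apply: ler_sum => r _; case: (d01 r) => ->.
  apply: (@le_trans _ _ (l%:R * t L)); last exact: ler_wpM2l.
  apply: le_trans (ler_wpM2l (ler0n _ l) (rate_sum_le L l)); rewrite mulr_sumr.
  apply: ler_sum_nat => r /andP[Lr rl]; rewrite -rate_mul; last by lia.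
  by apply: ler_wpM2r; rewrite ?rate_ge0 // ler_nat ltnW.
lra.
Qed.

Lemma total_weight1_ge K N : exists M, K <= total_weight 1 N M.
Proof.
have [N0 _ h] := many_zeroes N.
exists (maxn N0 (Num.truncn (2 * K)).+1); rewrite total_weightE.
under eq_bigr do rewrite esymm0 mulr1.
apply: le_trans (h _ (leq_maxl _ _)); rewrite ler_pdivlMr // mulrC.
apply: ltW; apply: lt_le_trans (truncnS_gt _) _.
by rewrite ler_nat leq_maxr.
Qed.

(** Sum over the second vertex [l] first. At least half of the vertices before
    [l] are available as root, which turns the factor [x l] into [d l / 2]; the
    remaining factor is compared with [t (l + 1) ^ m] by [expr_le_esymm], where
    all rates after [l] are at most [1 / l]. The error terms, multiples of
    [d l / l = x l], have a bounded sum. *)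
Lemma total_weight2_ge m K N :
  (\sum_(1 <= l <oo) ((d l)%:R%:E * tail R d l.+1 ^+ m) = +oo)%E ->
  exists M, K <= total_weight m.+2 N M.
Proof.
move=> doo; have [N0 /andP[N00 NN0] hN0] := many_zeroes N.
pose S l M : R := \sum_(l.+1 <= i < M) x i.
have S0 l M : 0 <= S l M by apply: sumr_ge0 => i _; exact: rate_ge0.
have St l M : S l M <= t 0.
  by apply: le_trans (rate_sum_le _ _) _; exact: fine_tail_le.
pose C : R := 'C(m, 2)%:R * t 0 ^+ m.-1.
have C0 : 0 <= C by rewrite mulr_ge0 // exprn_ge0 // fine_tail_ge0.
pose D L M : R := \sum_(N0 <= l < L) (d l)%:R * S l M ^+ m.
have D0 l M : 0 <= (d l)%:R * S l M ^+ m by rewrite mulr_ge0 // exprn_ge0.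
have lower M : D M M - C * t 0 <= 2 * m`!%:R * total_weight m.+2 N M.
  pose E l := esymm x m (index_iota l.+1 M).
  have E0 l : 0 <= E l by apply: esymm_ge0 => i; exact: rate_ge0.
  have tw : \sum_(N0 <= l < M) (d l)%:R * E l <= 2 * total_weight m.+2 N M.
    rewrite total_weight2E.
    have F0 l : 0 <= (\sum_(N <= r < l) zero r) * x l * E l.
      by rewrite !mulr_ge0 ?rate_ge0 // sumr_ge0.
    apply: (@le_trans _ _ (2 * \sum_(N0 <= l < M)
        (\sum_(N <= r < l) zero r) * x l * E l)).
      rewrite mulr_sumr; apply: ler_sum_nat => l /andP[Nl lM].
      rewrite mulrA; apply: ler_wpM2r => //.
      rewrite -rate_mul; last exact: leq_trans Nl.
      rewrite mulrA; apply: ler_wpM2r; first exact: rate_ge0.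
      by have := hN0 l Nl; lra.
    apply: ler_wpM2l => //; have [N0M|MN0] := leqP N0 M.
      by rewrite [leRHS](big_cat_nat NN0 N0M) /= lerDr sumr_ge0.
    by rewrite big_geq ?sumr_ge0 // ltnW.
  apply: le_trans (_ : m`!%:R * \sum_(N0 <= l < M) (d l)%:R * E l <= _); last first.
    by rewrite [2 * _]mulrC -mulrA; apply: ler_wpM2l.
  rewrite lerBlDr.
  apply: (@le_trans _ _ (m`!%:R * (\sum_(N0 <= l < M) (d l)%:R * E l) +
      C * \sum_(N0 <= l < M) x l)); last first.
    rewrite lerD2l; apply: ler_wpM2l => //.
    by apply: le_trans (rate_sum_le _ _) _; exact: fine_tail_le.
  rewrite !mulr_sumr -big_split /=; apply: ler_sum_nat => l /andP[Nl lM].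
  have l0 : (0 < l)%N by exact: leq_trans Nl.
  have /(ler_wpM2l (ler0n R (d l))) := @expr_le_esymm _ _ rate_ge0 l%:R^-1 m
    (index_iota l.+1 M) (ltac:(by rewrite invr_ge0)) (fun i il => rate_le l0
      (proj1 (andP (etrans (esym (mem_index_iota _ _ _)) il)))).
  rewrite -/(S l M) -/(E l) => /le_trans; apply.
  rewrite mulrDr [_ * (m`!%:R * _)]mulrCA lerD2l.
  rewrite [leLHS](_ : _ = 'C(m, 2)%:R * x l * S l M ^+ m.-1); last first.
    by rewrite /rate; move: (_ ^+ _) l%:R^-1 => e y; ring.
  rewrite -mulrA [x l * _]mulrC mulrA; apply: ler_wpM2r; first exact: rate_ge0.
  by apply: ler_wpM2l => //; apply: lerXn2r; rewrite ?nnegrE ?fine_tail_ge0.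
have [M DM] : exists M, 2 * m`!%:R * K + C * t 0 <= D M M.
  set K' := _ + _; pose f l : R := (d l)%:R * t l.+1 ^+ m.
  have f0 l : 0 <= f l by rewrite mulr_ge0 // exprn_ge0 // fine_tail_ge0.
  have foo : (\sum_(1 <= l <oo) (f l)%:E = +oo)%E.
    rewrite -doo; apply: eq_eseriesr => l _.
    by rewrite tailE EFinM EFin_expe.
  have [L KL] := divergent_series_ge f0 foo (K' + 1 + \sum_(1 <= l < N0) f l).
  have {L KL} [L KL] : exists L, K' + 1 <= \sum_(N0 <= l < L) f l.
    exists (maxn L N0); have := le_trans KL (ler_sum_nat_widen f0 1 (leq_maxl L N0)).
    by rewrite (big_cat_nat N00 (leq_maxr L N0)) /=; lra.
  have DL : D L M @[M --> \oo] --> \sum_(N0 <= l < L) f l.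
    apply: (cvg_big (@add_continuous R)) => l _; apply: cvgMl_tmp.
    apply: (@cvg_comp _ _ _ (S l) (fun y : R => y ^+ m)).
      exact: (cvg_partial_tail rate_ge0 x_lty).
    exact: exprn_continuous.
  have [M LM DLM] : exists2 M, (L <= M)%N & K' <= D L M.
    have /cvgrPdist_lt/(_ 1 ltr01) [M0 _ hM] := DL.
    exists (maxn L M0); first exact: leq_maxl.
    by have := hM _ (leq_maxr L M0); rewrite ltr_norml; lra.
  exists M; apply: le_trans DLM _; exact: ler_sum_nat_widen.
exists M; have f0 : 0 < 2 * m`!%:R :> R by rewrite mulr_gt0 ?ltr0n ?fact_gt0.
rewrite -(ler_pM2l f0); have := lower M; lra.
Qed.

End Rates.

(** * First and second moment bounds *)

Section Moments.
Context (R : realType) (disp : measure_display) (T : measurableType disp).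
Variable P : probability T R.

Definition pr (A : set T) : R := fine (P A).

Lemma prE A : measurable A -> P A = (pr A)%:E.
Proof. by move=> mA; rewrite fineK // fin_num_measure. Qed.

Lemma pr_ge0 A : 0 <= pr A.
Proof. exact/fine_ge0/measure_ge0. Qed.

(** Inequalities between nonnegative combinations of indicators integrate to
    inequalities between probabilities. *)
Lemma indicator_sum_le (I J : Type) (s : seq I) (t : seq J)
    (c : I -> R) (A : I -> set T) (e : J -> R) (B : J -> set T) :
  (forall i, 0 <= c i) -> (forall i, measurable (A i)) ->
  (forall j, 0 <= e j) -> (forall j, measurable (B j)) ->
  (forall w, \sum_(i <- s) c i * \1_(A i) w <= \sum_(j <- t) e j * \1_(B j) w) ->
  \sum_(i <- s) c i * pr (A i) <= \sum_(j <- t) e j * pr (B j).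
Proof.
have intE (K : Type) (u : seq K) (k : K -> R) (C : K -> set T) :
    (forall i, 0 <= k i) -> (forall i, measurable (C i)) ->
    (\int[P]_w (\sum_(i <- u) k i * \1_(C i) w)%:E)%E =
    (\sum_(i <- u) k i * pr (C i))%:E.
  move=> k0 mC; under eq_integral do rewrite -sumEFin.
  have mk i : measurable_fun [set: T] (fun w => (k i * \1_(C i) w)%:E).
    by apply/measurable_EFinP; apply: measurable_funM.
  rewrite ge0_integral_sum //; last first.
    by move=> i w _; rewrite lee_fin mulr_ge0.
  rewrite -sumEFin; apply: eq_bigr => i _; rewrite EFinM -prE //.
  under eq_integral do rewrite EFinM.
  rewrite ge0_integralZl_EFin // ?integral_indic ?setIT //.
  exact/measurable_EFinP.
move=> c0 mA e0 mB le; rewrite -lee_fin -!intE //.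
have msum (K : Type) (u : seq K) (k : K -> R) (C : K -> set T) :
    (forall i, measurable (C i)) ->
    measurable_fun [set: T] (fun w => (\sum_(i <- u) k i * \1_(C i) w)%:E).
  move=> mC; apply/measurable_EFinP; apply: measurable_sum => i.
  exact: measurable_funM.
apply: ge0_le_integral => //; try exact: msum.
  by move=> w _; rewrite lee_fin sumr_ge0 // => i _; rewrite mulr_ge0.
by move=> w _; rewrite lee_fin.
Qed.

Lemma le_pr A B : measurable A -> measurable B -> A `<=` B -> pr A <= pr B.
Proof.
by move=> mA mB AB; rewrite fine_le ?fin_num_measure // le_measure ?inE.
Qed.

Lemma pr_union_le (I : eqType) (s : seq I) (E : I -> set T) A :
  measurable A -> (forall i, measurable (E i)) ->
  (forall w, A w -> exists2 i, i \in s & E i w) ->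
  pr A <= \sum_(i <- s) pr (E i).
Proof.
move=> mA mE AE.
have := @indicator_sum_le unit I [:: tt] s (fun=> 1) (fun=> A) (fun=> 1) E.
rewrite big_seq1 mul1r => /(_ _ _ _ _ _)/le_trans; apply=> //; last first.
  by apply: ler_sum => i _; rewrite mul1r.
move=> w; rewrite big_seq1 mul1r; under eq_bigr do rewrite mul1r.
rewrite indicE; have [/set_mem/AE[i is_ Ei]|_] := boolP (w \in A); last first.
  by rewrite sumr_ge0.
rewrite (big_rem i) //= indicE mem_set //.
by rewrite lerDl sumr_ge0.
Qed.

Lemma pr_increasing_union_le (B : nat -> set T) A K :
  measurable A -> (forall M, measurable (B M)) ->
  (forall M M', (M <= M')%N -> B M `<=` B M') -> A `<=` \bigcup_M B M ->
  (forall M, pr (B M) <= K) -> pr A <= K.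
Proof.
move=> mA mB Bincr AB BK; have mU : measurable (\bigcup_M B M).
  exact: bigcupT_measurable.
apply: le_trans (le_pr mA mU AB) _; rewrite -lee_fin -prE //.
have /cvg_lim <- // : P \o B @ \oo --> P (\bigcup_M B M).
  apply: nondecreasing_cvg_mu => // M M' MM'; exact/subsetPset/Bincr.
apply: lime_le.
  apply/cvg_ex; exists (P (\bigcup_M B M)); apply: nondecreasing_cvg_mu => // M M' MM'.
  exact/subsetPset/Bincr.
by apply: nearW => M /=; have := BK M; rewrite -lee_fin -prE.
Qed.

(** Let [X] be the number of the events [E i] that occur and [Q] the sum of the
    weights. On [A], where [X = 0], the square of [X - Q] is [Q ^ 2]; its
    expectation is at most [Q + 2 eps Q ^ 2], because [X] has expectation at
    least [(1 - eps) Q] and two events are at most as likely to occur together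
    as independent events of probabilities [q i] and [q j]. *)
Lemma second_moment (I : eqType) (s : seq I) (E : I -> set T) (q : I -> R) eps A :
  uniq s -> (forall i, measurable (E i)) -> measurable A -> (forall i, 0 <= q i) ->
  (forall i, i \in s -> pr (E i) <= q i) ->
  (forall i, i \in s -> (1 - eps) * q i <= pr (E i)) ->
  (forall i j, i \in s -> j \in s -> i != j -> pr (E i `&` E j) <= q i * q j) ->
  (forall w, A w -> forall i, i \in s -> ~ E i w) ->
  pr A * (\sum_(i <- s) q i) ^+ 2 <=
    \sum_(i <- s) q i + 2 * eps * (\sum_(i <- s) q i) ^+ 2.
Proof.
move=> us mE mA q0 Eq qE EE AE; set Q := \sum_(i <- s) q i.
have Q0 : 0 <= Q by exact: sumr_ge0.
(* The inequality [Q^2 1_A + 2 Q X <= Q^2 + X^2] between nonnegative functions,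
   with [None] for the terms [Q^2 1_A] and [Q^2]. *)
pose c (i : option I) : R := if i is Some _ then 2 * Q else Q ^+ 2.
pose B (i : option I) := if i is Some i then E i else A.
pose e (j : option (I * I)) : R := if j is Some _ then 1 else Q ^+ 2.
pose D (j : option (I * I)) := if j is Some (i, j) then E i `&` E j else setT.
have := @indicator_sum_le _ _ (None :: map Some s)
  (None :: map Some [seq (i, j) | i <- s, j <- s]) c B e D.
rewrite !big_cons !big_map !big_allpairs /= => h.
have {h} : Q ^+ 2 * pr A + \sum_(i <- s) 2 * Q * pr (E i) <=
    Q ^+ 2 * pr setT + \sum_(i <- s) \sum_(j <- s) 1 * pr (E i `&` E j).
  apply: h; rewrite /c /B /e /D.
  - by move=> [i|]; rewrite ?mulr_ge0 // exprn_ge0.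
  - by move=> [i|].
  - by move=> [i|]; rewrite ?exprn_ge0.
  - by move=> [[i j]|] //; exact: measurableI.
  move=> w; rewrite !big_cons !big_map !big_allpairs /=.
  set X : R := \sum_(i <- s) \1_(E i) w.
  have -> : \sum_(i <- s) 2 * Q * \1_(E i) w = 2 * Q * X by rewrite -mulr_sumr.
  have -> : \sum_(i <- s) \sum_(j <- s) 1 * \1_(E i `&` E j) w = X * X.
    rewrite /X mulr_suml; apply: eq_bigr => i _; rewrite mulr_sumr.
    by apply: eq_bigr => j _; rewrite mul1r indicI.
  rewrite indicT mulr1 indicE.
  have [/set_mem Aw|_] := boolP (w \in A); last first.
    by rewrite mulr0 add0r; have := sqr_ge0 (X - Q); nra.
  have -> : X = 0.
    rewrite /X big_seq big1 // => i is_; rewrite indicE memNset //.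
    exact: AE Aw i is_.
  by rewrite !mulr0 mulr1.
have -> : pr setT = 1 by rewrite /pr probability_setT.
rewrite mulr1 -mulr_sumr.
have sumE : (1 - eps) * Q <= \sum_(i <- s) pr (E i).
  by rewrite mulr_sumr big_seq [leRHS]big_seq; apply: ler_sum.
have sumEE : \sum_(i <- s) \sum_(j <- s) 1 * pr (E i `&` E j) <= Q + Q * Q.
  rewrite /Q mulr_suml -big_split /= big_seq [leRHS]big_seq.
  apply: ler_sum => i is_; rewrite mulr_sumr (bigD1_seq i is_ us) /=.
  rewrite [X in _ <= _ + X](bigD1_seq i is_ us) /= mul1r setIid.
  apply: lerD; first exact: Eq.
  rewrite ler_wpDl ?mulr_ge0 // big_seq_cond [leRHS]big_seq_cond.
  by apply: ler_sum => j /andP[js ji]; rewrite mul1r EE // eq_sym.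
have := ler_wpM2l Q0 sumE; rewrite !expr2; lra.
Qed.

(** The first Borel-Cantelli lemma. *)
Lemma finitely_many_occur (E : nat -> set T) (f : nat -> R) :
  (forall n, measurable (E n)) -> (forall n, pr (E n) <= f n) ->
  (\sum_(0 <= n <oo) (f n)%:E < +oo)%E ->
  {ae P, forall w, finite_set [set n | E n w]}.
Proof.
move=> mE Ef foo; exists (lim_sup_set E); split.
- by apply: bigcapT_measurable => n; exact: bigcup_measurable.
- apply: lim_sup_set_cvg0 => //; apply: le_lt_trans foo.
  by apply: lee_nneseries => // n _; have := Ef n; rewrite -lee_fin -prE.
move=> w /= winf n _; have [m nm Em] : exists2 m, (n <= m)%N & E m w.
  apply: contrapT => h; apply: winf; apply: (sub_finite_set _ (finite_II n)).
  move=> m /= Em; rewrite ltnNge; apply/negP => nm; apply: h; by exists m.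
by exists m.
Qed.

Lemma pr_null A : measurable A -> (forall e, 0 < e -> pr A <= e) -> P A = 0%E.
Proof.
move=> mA Ae; rewrite prE //; congr _%:E; apply/eqP; rewrite eq_le pr_ge0 andbT.
by rewrite leNgt; apply/negP => A0; have := Ae (pr A / 2); lra.
Qed.

End Moments.

(** * The random parent function *)

(** For a set with at most one element, that element. *)
Definition chosen (n : nat) (B : {set 'I_n}) : option nat :=
  omap (@nat_of_ord n) [pick k in B].

Lemma chosen_mem n (B : {set 'I_n}) j :
  chosen B = Some j -> exists h : (j < n)%N, Ordinal h \in B.
Proof.
rewrite /chosen; case: pickP => //= k kB [<-].
by exists (ltn_ord k); rewrite (_ : Ordinal _ = k) //; exact: val_inj.
Qed.

Lemma chosen_eqP n (B : {set 'I_n}) j : (#|B| <= 1)%N ->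
  chosen B = Some j <-> exists h : (j < n)%N, Ordinal h \in B.
Proof.
move=> B1; split; first exact: chosen_mem.
case=> h hB; rewrite /chosen; case: pickP => [k kB|/(_ (Ordinal h))].
  by rewrite /= -(card_le1_eqP B1 _ _ kB hB).
by rewrite hB.
Qed.

Lemma chosen0 n : chosen (finset.set0 : {set 'I_n}) = None.
Proof. by rewrite /chosen; case: pickP => // k; rewrite inE. Qed.

Section RandomParent.
Context (R : realType) (disp : measure_display) (T : measurableType disp).
Variables (P : probability T R) (d : nat -> nat).
Variable A : forall i : nat, T -> {set 'I_i}.
Hypothesis d01 : forall n, d n = 0%N \/ d n = 1%N.
Hypothesis hA : graph_process P d A.

Definition parent (w : T) (i : nat) : option nat := chosen (A i w).

Lemma parent_ltn w : parent_decreases (parent w).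
Proof. by move=> i j /chosen_mem[]. Qed.

Let preimage_seq i (s : seq {set 'I_i}) : uniq s ->
  measurable (A i @^-1` [set` s]) /\
  P (A i @^-1` [set` s]) = (\sum_(B <- s) P (A i @^-1` [set B]))%E.
Proof.
have [_ mA _ _] := hA; elim: s => [_|B s ih /= /andP[Bs us]].
  by rewrite classical_sets.set_nil preimage_set0 big_nil measure0; split.
have [mS PS] := ih us; have -> : [set` B :: s] = [set B] `|` [set` s].
  by apply/seteqP; split=> C /=; rewrite inE => /predU1P.
rewrite preimage_setU big_cons.
split; first exact: measurableU.
rewrite -PS; apply: (measureU P (mA i B) mS).
by apply/seteqP; split=> // w [/= wB ws]; move: Bs; rewrite -wB ws.
Qed.

Let measurable_preimage i (E : set {set 'I_i}) : measurable (A i @^-1` E).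
Proof.
rewrite (_ : E = [set` [seq B <- enum {set 'I_i} | `[< E B >]]]).
  by apply: (proj1 (preimage_seq _)); exact/filter_uniq/enum_uniq.
by apply/seteqP; split=> B /=; rewrite mem_filter mem_enum andbT => /asboolP.
Qed.

Let pr_preimage i (E : pred {set 'I_i}) : pr P (A i @^-1` [set B | E B]) =
  \sum_(B | E B) (if #|B| == d i then ('C(i, d i)%:R)^-1 else 0).
Proof.
have [_ _ Aunif _] := hA; apply: EFin_inj; rewrite -prE // -sumEFin.
have -> : [set B | E B] = [set` enum E].
  by apply/seteqP; split=> B /=; rewrite mem_enum.
rewrite (preimage_seq (enum_uniq E)).2 big_enum.
by apply: eq_bigr => B _; exact: Aunif.
Qed.

Lemma measurable_parent i o : measurable [set w | parent w i = o].
Proof. exact: (measurable_preimage [set B | chosen B = o]). Qed.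

Definition parent_law (i : nat) (o : option nat) : R :=
  match o with
  | Some j => if (j < i)%N then rate R d i else 0
  | None => (d i == 0%N)%:R
  end.

Lemma parent_law_ge0 i o : 0 <= parent_law i o.
Proof. by case: o => [j|] /=; [case: ifP|]; rewrite ?rate_ge0. Qed.

Lemma pr_parent i o : pr P [set w | parent w i = o] = parent_law i o.
Proof.
have := pr_preimage (fun B : {set 'I_i} => chosen B == o).
rewrite [X in pr P X](_ : _ = [set w | parent w i = o]); last first.
  by apply/seteqP; split=> w /= /eqP.
move=> ->; rewrite -big_mkcondr /=.
have [d0|d1] := d01 i.
  rewrite d0 bin0 invr1 /parent_law d0 eqxx.
  rewrite (eq_bigl (fun B => (B == finset.set0) && (o == None))); last first.
    move=> B; rewrite cards_eq0.
    have [->|] := eqVneq B finset.set0; last by rewrite andbF.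
    by rewrite chosen0 andbT eq_sym.
  case: o => [j|]; last by under eq_bigl do rewrite andbT; rewrite big_pred1_eq.
  under eq_bigl do rewrite andbF; rewrite big_pred0_eq /rate d0 mul0r.
  by case: ifP.
rewrite d1 bin1 /parent_law d1 /=; case: o => [j|]; last first.
  rewrite big1 // => B /andP[/eqP cB /eqP/eqP/cards1P[k Bk]].
  by move: cB; rewrite Bk /chosen; case: pickP => // /(_ k); rewrite inE eqxx.
case: ifP => [ji|ji]; last first.
  by rewrite big1 // => B /andP[/eqP/chosen_mem[h _]]; rewrite h in ji.
rewrite (big_pred1 (finset.set1 (Ordinal ji))) ?/rate ?d1 ?mul1r // => B.
apply/andP/eqP => [[/eqP/chosen_mem[h hB] /cards1P[k Bk]]|->].
  move: hB; rewrite Bk inE => /eqP <-; congr finset.set1; exact: val_inj.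
rewrite cards1 eqxx; split=> //; apply/eqP/chosen_eqP; first by rewrite cards1.
by exists ji; rewrite inE.
Qed.

Lemma measurable_parents (J : seq nat) (o : nat -> option nat) :
  measurable [set w | forall i, i \in J -> parent w i = o i].
Proof.
rewrite (_ : [set _ | _] = \bigcap_(i in [set` J]) [set w | parent w i = o i]) //.
by apply: bigcap_measurableType => i _; exact: measurable_parent.
Qed.

(** Independence of the rounds, in terms of parents. *)
Lemma pr_parents (J : seq nat) (o : nat -> option nat) : uniq J ->
  pr P [set w | forall i, i \in J -> parent w i = o i] =
  \prod_(i <- J) parent_law i (o i).
Proof.
move=> uJ; have [_ _ _ indep] := hA.
have := indep J (fun i => [set B | chosen B = o i]) uJ.
rewrite [X in P X](_ : _ = [set w | forall i, i \in J -> parent w i = o i]) //.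
rewrite prE; last exact: measurable_parents.
rewrite (eq_bigr (fun i => (parent_law i (o i))%:E)) => [|i _].
  by rewrite prodEFin => -[].
by rewrite -pr_parent -prE //; exact: measurable_parent.
Qed.

Lemma ae_card_round : {ae P, forall w i, #|A i w| = d i}.
Proof.
apply: ae_foralln => i.
exists (A i @^-1` [set B : {set 'I_i} | #|B| != d i]); split.
- exact: measurable_preimage.
- suff : P (A i @^-1` [set B : {set 'I_i} | #|B| != d i]) = 0%E by [].
  by rewrite prE // pr_preimage big1 // => B /negPf ->.
- by move=> w /= /eqP.
Qed.

Lemma ae_parent_None : {ae P, forall w i, parent w i = None <-> d i = 0%N}.
Proof.
apply: filterS ae_card_round => w cw i; rewrite -cw /parent /chosen.
case: pickP => [k kA|noA] /=; split=> //.
  by move=> /eqP; rewrite cards_eq0 => /eqP A0; rewrite A0 inE in kA.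
by move=> _; apply/eqP; rewrite cards_eq0; apply/eqP/setP => k; rewrite noA inE.
Qed.

Lemma ae_random_graph : {ae P, forall w,
  iso (random_graph A w) (parent_graph (parent w))}.
Proof.
apply: filterS ae_card_round => w cw; exists id; split; first by exists id.
move=> x y; rewrite (parent_adj (@parent_ltn w)) /= /parent !chosen_eqP.
- by rewrite /generated or_comm.
- by rewrite cw; case: (d01 y) => ->.
by rewrite cw; case: (d01 x) => ->.
Qed.

End RandomParent.

(** * Almost sure properties of the random parent function *)

Lemma measurable_countable_bigcup (disp : measure_display)
    (T : measurableType disp) (U : countType) (D : set U) (F : U -> set T) :
  (forall u, measurable (F u)) -> measurable (\bigcup_(u in D) F u).
Proof.
move=> mF; rewrite bigcup_mkcond; apply: countable_bigcupT_measurable => [|u].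
  exact: countableP.
by case: ifP.
Qed.

Lemma measurable_countable_bigcap (disp : measure_display)
    (T : measurableType disp) (U : countType) (D : set U) (F : U -> set T) :
  (forall u, measurable (F u)) -> measurable (\bigcap_(u in D) F u).
Proof.
move=> mF; rewrite -[X in measurable X]setCK setC_bigcap; apply: measurableC.
by apply: measurable_countable_bigcup => u; exact/measurableC/mF.
Qed.

Lemma root_path (p : nat -> option nat) r v : parent_decreases p ->
  root_of p v = r -> v != r -> exists c, path ltn r (rcons c v) /\
    forall j, (j < size (rcons c v))%N ->
      p (nth 0%N (rcons c v) j) = Some (nth 0%N (r :: rcons c v) j).
Proof.
move=> p_lt; elim/ltn_ind: v => v ih; rewrite rootE //.
case E: (p v) => [u|]; last by move=> ->; rewrite eqxx.
move=> ur vr; have uv := p_lt _ _ E.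
have [ru|ru] := eqVneq u r.
  by exists [::]; subst u; split=> [|[|//]] /=; rewrite ?uv.
have [c [rc cp]] := ih u uv ur ru; exists (rcons c u); split.
  by rewrite rcons_path rc last_rcons.
move=> j; rewrite size_rcons ltnS leq_eqVlt => /predU1P[->|jc].
  by rewrite nth_rcons ltnn eqxx E -rcons_cons nth_rcons /= ltnSn -last_nth last_rcons.
rewrite nth_rcons jc cp // -!rcons_cons [in RHS]nth_rcons /=.
by rewrite ltnS ltnW.
Qed.

Section AlmostSure.
Context (R : realType) (disp : measure_display) (T : measurableType disp).
Variables (P : probability T R) (d : nat -> nat).
Variable A : forall i : nat, T -> {set 'I_i}.
Hypothesis d01 : forall n, d n = 0%N \/ d n = 1%N.
Hypothesis hA : graph_process P d A.

Local Notation x := (rate R d).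
Local Notation par := (parent A).
Local Notation law := (parent_law R d).

Let x_ge0 := rate_ge0 R d.

Let law_le i j : law i (Some j) <= x i.
Proof. by rewrite /=; case: ifP. Qed.

(** * Infinitely many children *)

(** The second moment bound with [eps = 0], as the rounds are independent: no
    vertex joins [v] from round [N] on with probability at most the inverse of a
    partial sum of the divergent series. *)
Lemma ae_infinitely_many_children : (\sum_(0 <= i <oo) (x i)%:E = +oo)%E ->
  {ae P, forall w v, infinite_set [set i | par w i = Some v]}.
Proof.
move=> xoo.
pose Z v N := [set w | forall i, (N <= i)%N -> ~ par w i = Some v].
have mZ v N : measurable (Z v N).
  rewrite (_ : Z v N = \bigcap_(i in [set i | (N <= i)%N])
    ~` [set w | par w i = Some v]) //.
  apply: bigcap_measurableType => i _; apply: measurableC.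
  exact: (measurable_parent hA).
have Z0 v N : P (Z v N) = 0%E.
  apply: pr_null => // e e0; pose N' := maxn N v.+1.
  have [M hM] := divergent_series_ge x_ge0 xoo (\sum_(0 <= i < N') x i + e^-1).
  set Q := \sum_(N' <= i < M) x i.
  have {hM} Qe : e^-1 <= Q.
    have [N'M|MN'] := leqP N' M.
      by move: hM; rewrite (big_cat_nat (leq0n _) N'M) /= lerD2l.
    have := le_trans hM (ler_sum_nat_widen x_ge0 0 (ltnW MN')).
    by rewrite gerDl leNgt invr_gt0 e0.
  have law_x i : i \in index_iota N' M -> law i (Some v) = x i.
    by rewrite mem_index_iota /= geq_max => /andP[/andP[_ ->]].
  have := @second_moment _ _ _ P _ (index_iota N' M)
    (fun i => [set w | par w i = Some v]) x 0 (Z v N) (iota_uniq _ _)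
    (fun i => measurable_parent hA i (Some v)) (mZ v N) x_ge0.
  rewrite -/Q mulr0 mul0r addr0 => sm.
  have {}sm : pr P (Z v N) * Q ^+ 2 <= Q.
    apply: sm => [i _|i iM|i j iM jM ij|w Zw i].
    - by rewrite (pr_parent d01 hA).
    - by rewrite subr0 mul1r (pr_parent d01 hA) law_x.
    - have uij : uniq [:: i; j] by rewrite /= inE ij.
      have := pr_parents d01 hA (fun=> Some v) uij.
      rewrite !big_cons big_nil mulr1 (law_x i iM) (law_x j jM) => <-.
      apply: le_pr => [||w [wi wj] k].
      + by apply: measurableI; exact: (measurable_parent hA).
      + exact: (measurable_parents hA).
      by rewrite !inE => /orP[] /eqP ->.
    rewrite mem_index_iota geq_max => /andP[/andP[Ni _] _]; exact: Zw.
  have Q0 : 0 < Q by apply: lt_le_trans Qe; rewrite invr_gt0.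
  have {}sm : pr P (Z v N) * Q <= 1.
    by rewrite -(ler_pM2r Q0) mul1r -mulrA -expr2.
  have := ler_wpM2l (pr_ge0 P (Z v N)) Qe => /le_trans/(_ sm).
  by rewrite ler_pdivrMr // mul1r.
have aeZ : {ae P, forall w v N, ~ Z v N w}.
  apply: ae_foralln => v; apply: ae_foralln => N.
  by exists (Z v N); split; [exact: mZ|exact: Z0|move=> w /= /contrapT].
apply: filterS aeZ => w wZ v /finite_seqP[s sE].
apply: (wZ v (\max_(i <- s) i).+1) => i si pi.
suff is_ : i \in s.
  by have := leq_bigmax_seq (P := predT) (F := id) i is_ isT; rewrite leqNgt si.
by have : [set i | par w i = Some v] i by []; rewrite sE.
Qed.

(** * Finite components *)

Hypothesis x_lty : (\sum_(0 <= i <oo) (x i)%:E < +oo)%E.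

Let t n : R := fine (tail R d n).

Let assigned (s : seq nat) (o : nat -> option nat) :=
  [set w | forall j, (j < size s)%N -> par w (nth 0%N s j) = o j].

Let assignedE s o : uniq s -> assigned s o =
  [set w | forall i, i \in s -> par w i = o (index i s)].
Proof.
move=> us; apply/seteqP; split=> w h.
  by move=> i is_; rewrite -h ?index_mem // nth_index.
by move=> j js; rewrite h ?mem_nth // index_uniq.
Qed.

Let measurable_assigned s o : measurable (assigned s o).
Proof.
rewrite (_ : assigned s o = \bigcap_(j in [set j | (j < size s)%N])
  [set w | par w (nth 0%N s j) = o j]) //.
by apply: bigcap_measurableType => j _; exact: (measurable_parent hA).
Qed.

Let pr_assigned s o : uniq s ->
  pr P (assigned s o) = \prod_(0 <= j < size s) law (nth 0%N s j) (o j).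
Proof.
move=> us; rewrite assignedE // (pr_parents d01 hA (fun i => o (index i s))) //.
rewrite (big_nth 0%N); apply: eq_big_nat => j /andP[_ js].
by rewrite index_uniq.
Qed.

(** A path from [r] down to [v] through the intermediate vertices [c] has the
    probability [x v * prod_(i <- c) x i]. Summed over [c], this is at most
    [x v * prod_i (1 + x i)], so that [v] lies below [r] with a probability that
    is summable over [v]. *)
Lemma ae_finite_components :
  {ae P, forall w r, finite_set [set v | root_of (par w) v = r]}.
Proof.
apply: ae_foralln => r.
pose L v := flatten [seq sublists m (index_iota r.+1 v) | m <- index_iota 0 v.+1].
pose F v c := assigned (rcons c v) (fun j => Some (nth 0%N (r :: rcons c v) j)).
pose E v := \bigcup_(c in [set` L v]) F v c.
have mF v c : measurable (F v c) by exact: measurable_assigned.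
have mE v : measurable (E v) by exact: measurable_countable_bigcup.
have E_le v : pr P (E v) <= expR (t 0) * x v.
  apply: (@le_trans _ _ (\sum_(c <- L v) pr P (F v c))).
    by apply: pr_union_le => // w [c cL cw]; exists c.
  rewrite big_flatten big_map.
  apply: (@le_trans _ _ (\sum_(0 <= m < v.+1) x v * esymm x m (index_iota r.+1 v))).
    apply: ler_sum => m _; rewrite mulr_sumr big_seq [leRHS]big_seq.
    apply: ler_sum => c; rewrite mem_sublists_iota => /and3P[sc _ /allP cv].
    rewrite pr_assigned; last first.
      rewrite rcons_uniq (sorted_uniq ltn_trans ltnn sc) andbT.
      by apply/negP => /cv; rewrite ltnn andbF.
    have -> : x v * \prod_(i <- c) x i = \prod_(i <- rcons c v) x i.
      by rewrite -cats1 big_cat big_seq1 mulrC.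
    rewrite [leRHS](big_nth 0%N).
    by apply: ler_prod => j _; rewrite parent_law_ge0 law_le.
  rewrite -mulr_sumr mulrC; apply: ler_wpM2r => //.
  apply: le_trans (sum_esymm_le x_ge0 _ _) _.
  apply: le_trans (prod_1D_le_expR x_ge0 _) _; rewrite ler_expR.
  apply: le_trans (rate_sum_le x_lty _ _) _; exact: fine_tail_le.
have fin : (\sum_(0 <= n <oo) (expR (t 0) * x n)%:E < +oo)%E.
  apply: (@bounded_series_lty _ _ _ _ (expR (t 0) * t 0)) => [i|M].
    by rewrite mulr_ge0 // expR_ge0.
  rewrite -mulr_sumr; apply: ler_wpM2l; first exact: expR_ge0.
  exact: rate_sum_le.
apply: filterS (finitely_many_occur mE E_le fin) => w wfin.
apply: (@sub_finite_set _ _ ([set r] `|` [set v | E v w])); last first.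
  by rewrite finite_setU.
move=> v /= vr; have [->|vr'] := eqVneq v r; [by left|right].
have [c [rc cp]] := root_path (@parent_ltn _ _ A w) vr vr'.
exists c => //=; move: rc.
rewrite (path_pairwise ltn_trans) /= pairwise_rcons all_rcons -andbA.
move=> /and4P[_ /allP rc /allP cv pc].
have cL : c \in sublists (size c) (index_iota r.+1 v).
  rewrite mem_sublists_iota eqxx (pairwise_sorted pc) /=.
  by apply/allP => i ic; rewrite cv // andbT; exact: rc.
apply/flattenP; exists (sublists (size c) (index_iota r.+1 v)) => //.
apply/mapP; exists (size c) => //; rewrite mem_index_iota /= ltnS.
move: cL; rewrite mem_sublists => /andP[/size_subseq]; rewrite size_iota => cs _.
by apply: leq_trans cs _; rewrite leq_subr.
Qed.

(** * Small trees occur infinitely often *)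

Let embedding q s := [set w | embeds (par w) q s].

Let measurable_embedding q s : measurable (embedding q s).
Proof. exact: (measurable_assigned s (fun j => omap (nth 0%N s) (q j))). Qed.

Let target q s i := omap (nth 0%N s) (q (index i s)).

Let embeddingE q s : uniq s ->
  embedding q s = [set w | forall i, i \in s -> par w i = target q s i].
Proof. exact: (@assignedE s (fun j => omap (nth 0%N s) (q j))). Qed.

Let pr_embedding q s : sorted ltn s -> tree_shape (size s) q ->
  \prod_(i <- s) law i (target q s i) = shape_weight R d s.
Proof.
move=> ss shq; have us : uniq s := sorted_uniq ltn_trans ltnn ss.
rewrite (big_nth 0%N) (eq_big_nat _ _ (F2 := fun j =>
  law (nth 0%N s j) (omap (nth 0%N s) (q j)))); last first.
  by move=> j /andP[_ js]; rewrite /target index_uniq.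
case: s ss shq {us} => [|r s] ss shq /=; first by rewrite big_geq.
rewrite big_nat_recl //= (shq 0%N) //=; congr (_ * _).
rewrite [RHS](big_nth 0%N); apply: eq_big_nat => j /andP[_ js].
have /= [k kj ->] := shq j.+1 js; rewrite /= ifT //.
apply: (sorted_ltn_nth ltn_trans 0%N ss k j.+1) => //; rewrite inE //=.
exact: leq_trans kj (ltnW _).
Qed.

Section Shape.
Variables (n : nat) (q : nat -> option nat).
Hypothesis n0 : (0 < n)%N.
Hypothesis shq : tree_shape n q.

Let occurrence s := [set w | occurs (par w) q s].

Let intrusion (s : seq nat) (ia : nat * nat) :=
  if ia.1 \in s then set0 else embedding q s `&` [set w | par w ia.1 = Some ia.2].

Let measurable_intrusion s ia : measurable (intrusion s ia).
Proof.
rewrite /intrusion; case: ifP => // _; apply: measurableI => //.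
exact: (measurable_parent hA).
Qed.

Let occurrenceE s : occurrence s =
  embedding q s `\` \bigcup_(ia in [set ia | ia.2 \in s]) intrusion s ia.
Proof.
rewrite /intrusion; apply/seteqP; split=> w [ew cw]; split=> //.
  by case=> -[i a] /= as_; case: ifP => // /negP is_ [_ ia]; exact/is_/cw/ia.
move=> i a as_ ia; apply/negPn/negP => is_; apply: cw; exists (i, a) => //=.
by rewrite (negPf is_).
Qed.

Let measurable_occurrence s : measurable (occurrence s).
Proof.
by rewrite occurrenceE; apply: measurableD => //; exact: measurable_countable_bigcup.
Qed.

Let occurrence_le s : sorted ltn s -> size s = n ->
  pr P (occurrence s) <= shape_weight R d s.
Proof.
move=> ss sn; rewrite -(@pr_embedding q) ?sn // -(pr_parents d01 hA); last first.
  exact: sorted_uniq ltn_trans ltnn _ ss.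
rewrite -embeddingE; last exact: sorted_uniq ltn_trans ltnn _ ss.
by apply: le_pr => //; rewrite occurrenceE; exact: subDsetl.
Qed.

(** An embedded shape fails to be a component only if some further vertex joins
    it. A given vertex [v_i] with [N <= i] does so with conditional probability
    at most [n * x i]. *)
Let occurrence_ge s N : sorted ltn s -> size s = n -> all (leq N) s ->
  (1 - n%:R * t N) * shape_weight R d s <= pr P (occurrence s).
Proof.
move=> ss sn /allP sN; have us : uniq s := sorted_uniq ltn_trans ltnn ss.
have shq' := shq; rewrite -sn in shq'.
set W := shape_weight R d s; set D := embedding q s.
have DW : pr P D = W by rewrite /D embeddingE // (pr_parents d01 hA) // pr_embedding.
pose B M := \bigcup_(ia in [set ia | (ia.1 < M)%N && (ia.2 \in s)]) intrusion s ia.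
have mB M : measurable (B M) by exact: measurable_countable_bigcup.
have intr_le ia : ia.2 \in s -> pr P (intrusion s ia) <=
    if (N <= ia.1)%N then W * x ia.1 else 0.
  case: ia => i a /= as_; rewrite /intrusion /=.
  have W0 : 0 <= W by exact: shape_weight_ge0.
  have [is_|is_] := boolP (i \in s).
    by rewrite /pr measure0; case: ifP => // _; rewrite mulr_ge0.
  rewrite /D embeddingE //.
  have -> : [set w | forall i0, i0 \in s -> par w i0 = target q s i0] `&`
      [set w | par w i = Some a] = [set w | forall j, j \in i :: s ->
        par w j = if j \in s then target q s j else Some a].
    apply/seteqP; split=> w /=.
      case=> h1 h2 j; rewrite inE => /predU1P[->|js]; first by rewrite (negPf is_).
      by rewrite js; exact: h1.
    move=> h; split=> [j js|]; first by have := h j; rewrite inE js orbT => /(_ isT).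
    by have := h i; rewrite mem_head (negPf is_) => /(_ isT).
  rewrite (pr_parents d01 hA) /= ?is_ // big_cons (negPf is_).
  rewrite (eq_big_seq (fun j => law j (target q s j))); last first.
    by move=> j js; rewrite js.
  rewrite pr_embedding // -/W mulrC /=; case: ltnP => [ai|ia]; last first.
    by rewrite mulr0; case: ifP => // _; rewrite mulr_ge0.
  by rewrite (leq_trans (sN _ as_) (ltnW ai)).
have BK M : pr P (B M) <= n%:R * t N * W.
  apply: (@le_trans _ _ (\sum_(ia <- [seq (i, a) | i <- index_iota 0 M, a <- s])
      pr P (intrusion s ia))).
    apply: pr_union_le => // w [[i a] /= /andP[iM as_] wi]; exists (i, a) => //.
    by apply: allpairs_f => //; rewrite mem_index_iota.
  rewrite big_allpairs.
  apply: (@le_trans _ _ (\sum_(0 <= i < M) n%:R * (if (N <= i)%N then W * x i else 0))).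
    apply: ler_sum => i _; rewrite -sn mulr_natl.
    rewrite -[leRHS]addr0 -iter_addr -count_predT -big_const_seq.
    by rewrite big_seq [leRHS]big_seq; apply: ler_sum => a /(intr_le (i, a)).
  rewrite -mulr_sumr -mulrA; apply: ler_wpM2l => //.
  rewrite (eq_bigr (fun i => W * (if (N <= i)%N then x i else 0))); last first.
    by move=> i _; case: ifP; rewrite ?mulr0.
  rewrite -mulr_sumr mulrC; apply: ler_wpM2r; first exact: shape_weight_ge0.
  rewrite -big_mkcond /=; apply: le_trans (rate_sum_le x_lty N M).
  by rewrite (big_nat_widenl N 0 M) //.
have DO : pr P (D `\` occurrence s) <= n%:R * t N * W.
  apply: (pr_increasing_union_le _ mB _ _ BK).
  - by apply: measurableD => //; rewrite /D.
  - move=> M M' MM' w [ia /= /andP[iM is_] h]; exists ia => //=.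
    by rewrite is_ (leq_trans iM).
  rewrite occurrenceE setDD => w [_ [ia /= is_ h]]; exists ia.1.+1 => //.
  by exists ia => //=; rewrite ltnSn.
have : pr P D <= pr P (occurrence s) + pr P (D `\` occurrence s).
  have := @pr_union_le _ _ _ P _ [:: true; false]
    (fun b => if b then occurrence s else D `\` occurrence s) D.
  rewrite !big_cons big_nil addr0; apply=> [|[]|w Dw]; rewrite /D //.
    exact: measurableD.
  by have [ow|ow] := pselect (occurrence s w); [exists true|exists false].
rewrite DW; lra.
Qed.

(** If the lists meet, the events exclude each other; otherwise the embeddings
    concern different rounds. *)
Let occurrences_le s s' : sorted ltn s -> size s = n -> sorted ltn s' ->
  size s' = n -> s != s' ->
  pr P (occurrence s `&` occurrence s') <= shape_weight R d s * shape_weight R d s'.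
Proof.
move=> ss sn ss' s'n ss'E; have us : uniq s := sorted_uniq ltn_trans ltnn ss.
have us' : uniq s' := sorted_uniq ltn_trans ltnn ss'.
have [meet|disj] := boolP (has (mem s) s').
  rewrite (_ : _ `&` _ = set0).
    by rewrite /pr measure0 mulr_ge0 // shape_weight_ge0.
  apply/seteqP; split=> // w [os os']; move/eqP: ss'E; apply.
  by apply: (occurs_disjoint (@parent_ltn _ _ A w) ss ss' _ _ os os' meet); rewrite ?sn.
have disj' i : i \in s' -> i \notin s by move=> /(hasPn disj).
have -> : shape_weight R d s * shape_weight R d s' =
    pr P (embedding q s `&` embedding q s').
  have -> : embedding q s `&` embedding q s' = [set w | forall i, i \in s ++ s' ->
      par w i = if i \in s then target q s i else target q s' i].
    rewrite !embeddingE //; apply/seteqP; split=> w.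
      move=> [h h'] i; rewrite mem_cat; have [is_ _|_ /= is_] := boolP (i \in s).
        exact: h.
      exact: h'.
    move=> h; split=> i is_; first by have := h i; rewrite mem_cat is_ => /(_ isT).
    have := h i; rewrite mem_cat is_ orbT => /(_ isT).
    by rewrite (negPf (disj' i is_)).
  rewrite (pr_parents d01 hA) ?cat_uniq ?us ?us' ?disj // big_cat /=.
  rewrite -!(@pr_embedding q) ?sn ?s'n //; congr (_ * _); apply: eq_big_seq => i is_.
    by rewrite is_.
  by rewrite (negPf (disj' i is_)).
apply: le_pr; [exact: measurableI|exact: measurableI|].
by apply: setISS => w; rewrite occurrenceE; case.
Qed.

(** By the second moment bound with [eps = n * t N], no occurrence after [N]
    exists with probability at most [2 * n * t N], as the total weight is
    arbitrarily large. This event only grows with [N], while the bound tends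
    to [0]. *)
Lemma ae_shape_occurs :
  (forall K N, exists M, K <= total_weight R d n N M) ->
  {ae P, forall w N, exists s, [/\ sorted ltn s, size s = n,
    (N <= nth 0 s 0)%N & occurs (par w) q s]}.
Proof.
move=> Qoo; apply: ae_foralln => N0.
pose Z N := \bigcap_(s in [set s | [/\ sorted ltn s, size s = n & all (leq N) s]])
  ~` occurrence s.
have mZ N : measurable (Z N).
  by apply: measurable_countable_bigcap => s; exact: measurableC.
have small N e : 0 < e -> pr P (Z N) <= 2 * (n%:R * t N) + e.
  move=> e0; have [M MQ] := Qoo e^-1 N.
  have memE s : s \in sublists n (index_iota N M) ->
      [/\ sorted ltn s, size s = n & all (leq N) s].
    rewrite mem_sublists_iota => /and3P[ss /eqP sn /allP sN]; split=> //.
    by apply/allP => i /sN/andP[].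
  have := @second_moment _ _ _ P _ (sublists n (index_iota N M)) occurrence
    (shape_weight R d) (n%:R * t N) (Z N) (uniq_sublists _ (iota_uniq _ _))
    measurable_occurrence (mZ N) (shape_weight_ge0 R d).
  rewrite -/(total_weight R d n N M); set Q := total_weight R d n N M => sm.
  have {}sm : pr P (Z N) * Q ^+ 2 <= Q + 2 * (n%:R * t N) * Q ^+ 2.
    apply: sm => [s /memE[]|s /memE[]|s s' /memE[ss sn _] /memE[ss' s'n _]|w Zw s /memE].
    - by move=> ss sn _; exact: occurrence_le.
    - by move=> ss sn sN; exact: occurrence_ge.
    - exact: occurrences_le.
    exact: Zw.
  have Q0 : 0 < Q by apply: lt_le_trans MQ; rewrite invr_gt0.
  have Qe : Q <= e * Q ^+ 2.
    rewrite expr2 mulrA; apply: ler_peMl; first exact: ltW.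
    by rewrite -(mulfV (lt0r_neq0 e0)); apply: ler_wpM2l => //; exact: ltW.
  by rewrite -(ler_pM2r (exprn_gt0 2 Q0)) mulrDl; lra.
have Z0 : P (Z N0) = 0%E.
  apply: pr_null => // e e0.
  (* [small N (e / 2)] then leaves [2 n t N <= e / 2]. *)
  have /cvgrPdist_lt/(_ (e / (4 * n%:R))) := fine_tail_cvg0 x_lty.
  case=> [|L _ tL]; first by rewrite divr_gt0 // mulr_gt0 // ltr0n.
  pose N := maxn N0 L; have : t N <= e / (4 * n%:R).
    have := tL N (leq_maxr _ _); rewrite sub0r normrN.
    by rewrite ger0_norm ?fine_tail_ge0 // => /ltW.
  rewrite ler_pdivlMr ?mulr_gt0 ?ltr0n // => tN.
  have ZZ : pr P (Z N0) <= pr P (Z N).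
    apply: le_pr => // w Zw s [ss sn /allP sN]; apply: Zw; split=> //.
    by apply/allP => i /sN; apply: leq_trans; exact: leq_maxl.
  apply: le_trans ZZ _; apply: le_trans (small N (e / 2) _) _; lra.
exists (Z N0); split; [exact: mZ|exact: Z0|move=> w /= h s [ss sn /allP sN] os].
apply: h; exists s; split=> //.
by apply: sN; rewrite mem_nth // sn.
Qed.

End Shape.

(** * Finitely many large components *)

(** Union bound over the shape, the root [r] and the later vertices [s]: the
    number [l] of choices of [r] cancels the denominator of [x l], and the sum
    over [s] of the products of the rates is at most [t (l + 1) ^ m]. *)
Lemma ae_finitely_many_large m :
  (\sum_(0 <= l <oo) ((d l)%:R * t l.+1 ^+ m)%:E < +oo)%E ->
  {ae P, forall w, finite_set [set l | exists r s q,
    [/\ sorted ltn [:: r, l & s], size s = m, tree_shape m.+2 q &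
        embeds (par w) q [:: r, l & s]]]}.
Proof.
move=> dt_lty.
(* Finitely many functions encode all the tree shapes of size [m + 2]. *)
pose F := {ffun 'I_m.+2 -> 'I_m.+2}.
pose shape (f : F) j := if j is 0 then None else Some (val (f (inord j))).
pose listed l (u : nat * seq nat * F) := [:: u.1.1, l & u.1.2].
pose E l u := if `[< [/\ sorted ltn (listed l u), size u.1.2 = m &
  tree_shape m.+2 (shape u.2)] >] then embedding (shape u.2) (listed l u) else set0.
have mE l u : measurable (E l u) by rewrite /E; case: ifP.
pose V l := \bigcup_u E l u.
have mV l : measurable (V l) by exact: measurable_countable_bigcup.
pose C : R := #|{: F}|%:R.
have E_le l u : pr P (E l u) <= x l * \prod_(i <- u.1.2) x i.
  have W0 : 0 <= x l * \prod_(i <- u.1.2) x i by rewrite mulr_ge0 // prodr_ge0.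
  rewrite /E; case: asboolP => [[su um shu]|_]; last by rewrite /pr measure0.
  rewrite embeddingE; last exact: sorted_uniq ltn_trans ltnn _ su.
  rewrite (pr_parents d01 hA); last exact: sorted_uniq ltn_trans ltnn _ su.
  rewrite pr_embedding //= ?um // big_cons.
  by apply: ler_piMl => //; case: eqP.
have V_le l : pr P (V l) <= C * ((d l)%:R * t l.+1 ^+ m).
  pose B M := \bigcup_(u in [set u | all (ltn^~ M) u.1.2]) E l u.
  have mB M : measurable (B M) by exact: measurable_countable_bigcup.
  apply: (pr_increasing_union_le (mV l) mB).
  - move=> M M' MM' w [u /= /allP uM wu]; exists u => //=.
    by apply/allP => i /uM iM; exact: leq_trans iM MM'.
  - move=> w [u _ wu]; exists (\max_(i <- u.1.2) i).+1 => //; exists u => //=.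
    by apply/allP => i iu; rewrite ltnS; exact: (leq_bigmax_seq (F := id)).
  move=> M.
  apply: (@le_trans _ _ (\sum_(u <- [seq (rs, f) | rs <- [seq (r, s) |
      r <- index_iota 0 l, s <- sublists m (index_iota l.+1 M)], f <- enum {: F}])
      pr P (E l u))).
    apply: pr_union_le; [exact: mB|exact: mE|move=> w [u /= uM wu]].
    exists u => //; move: wu; rewrite /E; case: asboolP => // -[].
    case: u uM => -[r s] f /= sM /andP[rl ls] sm shf _.
    rewrite allpairs_f ?mem_enum // allpairs_f ?mem_index_iota //.
    rewrite mem_sublists_iota (path_sorted ls) sm eqxx /=.
    apply/allP => i is_; rewrite (allP sM) // andbT.
    exact: (allP (order_path_min ltn_trans ls)).
  rewrite big_allpairs big_allpairs /=.
  apply: (@le_trans _ _ (\sum_(0 <= r < l) C * (x l * esymm x m (index_iota l.+1 M)))).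
    apply: ler_sum => r _; rewrite /esymm !mulr_sumr; apply: ler_sum => s _.
    rewrite big_enum /= mulr_natl -sumr_const.
    by apply: ler_sum => f _; exact: E_le.
  rewrite sumr_const_nat subn0 -[leLHS]mulr_natl mulrCA; apply: ler_wpM2l => //.
  rewrite mulrA; case: (posnP l) => [->|l0].
    by rewrite mulr0n !mul0r mulr_ge0 // exprn_ge0 // fine_tail_ge0.
  rewrite rate_mul //; apply: ler_wpM2l => //.
  apply: le_trans (esymm_le_expr x_ge0 _ _) _.
  by apply: lerXn2r; rewrite ?nnegrE ?sumr_ge0 ?fine_tail_ge0 // rate_sum_le.
have fin : (\sum_(0 <= l <oo) (C * ((d l)%:R * t l.+1 ^+ m))%:E < +oo)%E.
  have f0 i : 0 <= (d i)%:R * t i.+1 ^+ m.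
    by rewrite mulr_ge0 // exprn_ge0 // fine_tail_ge0.
  apply: (@bounded_series_lty _ _ _ _ (C * fine (\sum_(0 <= l <oo)
    ((d l)%:R * t l.+1 ^+ m)%:E)%E)) => [i|M]; first by rewrite mulr_ge0.
  by rewrite -mulr_sumr; apply: ler_wpM2l => //; exact: partial_le_tail.
apply: filterS (finitely_many_occur mV V_le fin) => w; apply: sub_finite_set.
move=> l /= [r [s [q [ss sm shq eq]]]].
pose f : F := [ffun j : 'I_m.+2 => inord (odflt 0%N (q j))].
have qf j : (j < m.+2)%N -> shape f j = q j.
  move=> jm; have := shq j jm; case: j jm => [//|j] jm [k kj qk].
  rewrite qk /shape ffunE inordK // qk /= inordK //.
  exact: leq_trans kj (ltnW jm).
exists (r, s, f) => //; rewrite /E asboolT => [j /=|].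
  by rewrite sm => jm; rewrite eq /= ?sm // -qf.
by split=> // j jm; have := shq j jm; rewrite qf //; case: j jm.
Qed.

(** * Arbitrarily large components *)

Lemma star_not_negligible n : infinite_set [set i | d i = 1%N] ->
  exists J : seq nat, [/\ uniq J, size J = n, 0%N \notin J &
    ~ P.-negligible [set w | forall i, i \in J -> par w i = Some 0%N]].
Proof.
move=> /infinite_nat_enum[e [einj e1 _]]; have [dle _ _ _] := hA.
have e0 i : (0 < e i)%N by have := dle (e i); rewrite (e1 i).
exists (map e (iota 0 n)); have uJ : uniq (map e (iota 0 n)).
  by rewrite map_inj_uniq ?iota_uniq.
split=> //; first by rewrite size_map size_iota.
  by apply/mapP => -[i _ i0]; have := e0 i; rewrite -i0.
have mS := measurable_parents hA (map e (iota 0 n)) (fun=> Some 0%N).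
move=> /(negligibleP P mS) PS.
have := pr_parents d01 hA (fun=> Some 0%N) uJ; rewrite /pr PS big_map /= => /esym/eqP.
rewrite prodf_seq_eq0 => /hasP[i _ /=]; rewrite e0 /rate e1 mul1r invr_eq0 pnatr_eq0.
by rewrite -leqn0 leqNgt e0.
Qed.

End AlmostSure.

(** * Almost sure events and atoms *)

Section Atoms.
Context (R : realType) (disp : measure_display) (T : measurableType disp).
Variables (P : probability T R) (A : forall i : nat, T -> {set 'I_i}).

Lemma ae_forall_countable (U : countType) (Q : U -> T -> Prop) :
  (forall u, {ae P, forall w, Q u w}) -> {ae P, forall w u, Q u w}.
Proof.
move=> Qae; have : {ae P, forall w k,
    if (choice.unpickle k : option U) is Some u then Q u w else True}.
  apply: ae_foralln => k; case: (choice.unpickle k : option U) => [u|].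
    exact: Qae.
  exact: aeW.
by apply: filterS => w Qw u; have := Qw (choice.pickle u); rewrite choice.pickleK.
Qed.

Lemma atom_ae (Q : T -> Prop) (V : Type) (G : sgraph V) :
  {ae P, forall w, Q w} -> atom P A G -> exists2 w, Q w & iso (random_graph A w) G.
Proof.
move=> Qae aG; apply: contrapT => noQ; apply: aG.
by apply: negligibleS Qae => w wG Qw; apply: noQ; exists w.
Qed.

End Atoms.

Lemma countable_iso (V W : Type) (G : sgraph V) (H : sgraph W) :
  iso G H -> countable [set: W] -> countable [set: V].
Proof.
move=> [f [/bij_inj finj _]] /countable_injP[g ginj].
apply/countable_injP; exists (g \o f) => x y _ _ gxy; apply: finj.
by apply: ginj gxy; rewrite inE.
Qed.

Lemma acyclic_iso (V W : Type) (G : sgraph V) (H : sgraph W) :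
  iso G H -> acyclic H -> acyclic G.
Proof.
move=> [f [/bij_inj finj fadj]]; apply: (acyclic_inj finj) => x y.
by rewrite fadj.
Qed.

Lemma infinite_degree_iso (V W : Type) (G : sgraph V) (H : sgraph W) :
  iso G H -> (forall v, infinite_set [set w | adj H v w]) ->
  forall v, infinite_set [set w | adj G v w].
Proof.
move=> [f [[g fK gK] fadj]] Hinf v fin; apply: (Hinf (f v)).
apply: sub_finite_set (finite_image f fin) => w vw.
by exists (g w); rewrite ?gK //= fadj gK.
Qed.

(** * Divergent series: omega-trees *)

Section Divergent.
Context (R : realType) (disp : measure_display) (T : measurableType disp).
Variables (P : probability T R) (d : nat -> nat).
Variable A : forall i : nat, T -> {set 'I_i}.
Hypothesis d01 : forall n, d n = 0%N \/ d n = 1%N.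
Hypothesis hA : graph_process P d A.
Hypothesis x_oo : (\sum_(0 <= i <oo) (rate R d i)%:E = +oo)%E.

Let ae_omega : {ae P, forall w, [/\ iso (random_graph A w) (parent_graph (parent A w)),
  forall i, parent A w i = None <-> d i = 0%N &
  forall v, infinite_set [set i | parent A w i = Some v]]}.
Proof.
have := ae_random_graph d01 hA; have := ae_parent_None hA.
have := ae_infinitely_many_children d01 hA x_oo.
by apply: filterS3 => w.
Qed.

Let zeroes_eq w : (forall i, parent A w i = None <-> d i = 0%N) ->
  (fun z => parent A w z = None) = (fun z => d z = 0%N).
Proof. by move=> h; apply/funext => z; exact/propext. Qed.

Lemma divergent_concentrated : concentrated P A.
Proof.
exists _, (omega_forest {z : nat | d z = 0%N}); apply: filterS ae_omega => w [wG w0 winf].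
apply: iso_trans wG _; rewrite -(zeroes_eq w0).
exact: parent_graph_omega_forest (@parent_ltn _ _ A w) winf.
Qed.

Lemma divergent_atom (V : Type) (G : sgraph V) : atom P A G ->
  (forall C, components G C -> omega_tree (induced_subgraph G C)) /\
  components G #= [set n | d n = 0%N].
Proof.
move=> /(atom_ae ae_omega)[w [wp w0 winf] /iso_sym wG].
have Gp := iso_trans wG wp; have p_lt := @parent_ltn _ _ A w; split.
  apply: component_omega_tree.
  - exact: countable_iso Gp (countableP _).
  - exact: acyclic_iso Gp (@parent_graph_acyclic _).
  apply: infinite_degree_iso Gp _ => v; apply: sub_infinite_set (winf v) => i vi.
  by apply/parent_adj => //; right.
have := card_components_parent_graph p_lt Gp.
by rewrite (_ : [set z | parent A w z = None] = [set n | d n = 0%N]) // (zeroes_eq w0).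
Qed.

End Divergent.

(** * Convergent series: finite components *)

Definition has_component_ge (n : nat) (V : Type) (G : sgraph V) :=
  exists c : 'I_n -> V, injective c /\ forall i j, reachable G (c i) (c j).

Lemma has_component_ge_iso n (V W : Type) (G : sgraph V) (H : sgraph W) :
  iso G H -> has_component_ge n G -> has_component_ge n H.
Proof.
move=> [f [fbij fadj]] [c [cinj cr]]; exists (f \o c); split.
  exact: inj_comp (bij_inj fbij) cinj.
by move=> i j; apply/(reachable_iso fbij fadj).
Qed.

Lemma has_component_ge_le m n (V : Type) (G : sgraph V) :
  (m <= n)%N -> has_component_ge n G -> has_component_ge m G.
Proof.
move=> mn [c [cinj cr]]; exists (c \o widen_ord mn); split=> [|i j]; last exact: cr.
by move=> i j /= /cinj/(congr1 val) /= /val_inj.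
Qed.

(** The graph on [{0, ..., m - 1}] whose edges are listed: a countable family
    that contains every finite graph up to isomorphism. *)
Definition listed_graph (u : nat * seq (nat * nat)) : sgraph 'I_u.1.
Proof.
apply: (@SGraph _ (fun i j : 'I_u.1 => i != j /\
  (((val i, val j) \in u.2) || ((val j, val i) \in u.2)))).
- by move=> i j; rewrite eq_sym orbC.
- by move=> i []; rewrite eqxx.
Defined.

Lemma finite_graph_listed (W : finType) (F : sgraph W) :
  exists u, iso F (listed_graph u).
Proof.
pose e (a : W) : 'I_#|W| := enum_rank a.
exists (#|W|, [seq (val (e a.1), val (e a.2)) |
  a <- enum {: W * W} & `[< adj F a.1 a.2 >]]), e; split.
  exact/enum_rank_bij.
have inl a b : ((val (e a), val (e b)) \in [seq (val (e a.1), val (e a.2)) |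
    a <- enum {: W * W} & `[< adj F a.1 a.2 >]]) <-> adj F a b.
  split=> [/mapP[[a' b']]|ab].
    rewrite mem_filter => /andP[/asboolP ab _] [].
    by move=> /val_inj/enum_rank_inj -> /val_inj/enum_rank_inj ->.
  apply/mapP; exists (a, b) => //; rewrite mem_filter mem_enum andbT.
  exact/asboolP.
move=> a b /=; split=> [ab|[_ /orP[/inl//|/inl/(@adj_sym _ _ _ _)//]]].
split; last by apply/orP; left; apply/inl.
by apply/eqP => /enum_rank_inj ab'; move: ab; rewrite ab'; exact: adj_irr.
Qed.

Lemma bigsum_adjE (I : Type) (V : I -> Type) (G : forall i, sgraph (V i)) u v :
  adj (bigsum G) u v -> exists i x y,
    [/\ u = existT V i x, v = existT V i y & adj (G i) x y].
Proof. by case=> i x y xy; exists i, x, y. Qed.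

(** The components of [gsum F (F_below (Some k))] are those of [F] and trees
    with fewer than [k] vertices. *)
Lemma no_large_component k (m : nat) (F : sgraph 'I_m) :
  ~ has_component_ge (m + k).+1 (gsum F (F_below (Some k))).
Proof.
move=> [c [cinj cr]].
pose S := ('I_m + {i : {i : nat | (1 <= i)%N /\ lt_or_infinity i (Some k)} &
  {c : tree_type (sval i) & {_ : nat & 'I_(sval i)}}})%type.
pose block (u : S) := match u with
  | inl _ => None
  | inr (existT i (existT c (existT n _))) =>
      Some (existT (fun i => (tree_type (sval i) * nat)%type) i (c, n)) end.
pose pos (u : S) : nat := match u with
  | inl x => val x
  | inr (existT i (existT c (existT n x))) => val x end.
have pos_lt u : (pos u < m + k)%N.
  case: u => [x|[i [c' [n x]]]] /=; first exact: ltn_addr.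
  by have [_ ik] := svalP i; rewrite ltn_addl //; exact: ltn_trans (valP x) ik.
have pos_inj u v : block u = block v -> pos u = pos v -> u = v.
  case: u v => [x|[i [c1 [n x]]]] [y|[j [c2 [n' y]]]] //=.
    by move=> _ /val_inj ->.
  move=> /(@Some_inj _ _ _) E; move: (projT1_eq E) (projT2_eq E) => /= e.
  move: c2 n' y {E}; case: j / e => c2 n' y /= [<- <-] /val_inj <-.
  by [].
have adj_block u v : adj (gsum F (F_below (Some k))) u v -> block u = block v.
  case: u v => [a|u] [b|v] h; [by []|by inversion h|by inversion h|].
  have {h} : adj (F_below (Some k)) u v by inversion h.
  move=> /bigsum_adjE[i [a [b [-> ->]]]] /bigsum_adjE[c' [a' [b' [-> ->]]]].
  by move=> /bigsum_adjE[n [y [z [-> ->]]]].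
have c_block i j : block (c i) = block (c j).
  by elim: (cr i j) => [a b /adj_block|//|a b e _ -> _].
have posc_inj : injective (fun i => Ordinal (pos_lt (c i))).
  by move=> i j [] /(pos_inj _ _ (c_block i j))/cinj.
by have := leq_card _ posc_inj; rewrite !card_ord ltnn.
Qed.

Section Convergent.
Context (R : realType) (disp : measure_display) (T : measurableType disp).
Variables (P : probability T R) (d : nat -> nat).
Variable A : forall i : nat, T -> {set 'I_i}.
Hypothesis d01 : forall n, d n = 0%N \/ d n = 1%N.
Hypothesis dinf : infinite_set [set n | d n = 1%N].
Hypothesis hA : graph_process P d A.
Hypothesis x_lty : (\sum_(0 <= i <oo) (rate R d i)%:E < +oo)%E.

Let k := threshold R d.

Let small_diverges n : lt_or_infinity n.+2 k ->
  (\sum_(1 <= l <oo) ((d l)%:R%:E * tail R d l.+1 ^+ n) = +oo)%E.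
Proof.
move=> nk; apply: contrapT => sum_fin.
pose K kappa := (2 <= kappa)%N /\
  (\sum_(1 <= l <oo) ((d l)%:R%:E * tail R d l.+1 ^+ (kappa - 2)) < +oo)%E.
have Kn : `[< K n.+2 >].
  by apply/asboolP; split=> //; rewrite !subSS subn0 ltey; exact/eqP.
move: nk; rewrite /k /threshold /min_or_infinity -/K.
case: pselect => [ex|noex _]; last by apply: noex; exists n.+2.
by case: ex_minnP => m _ /(_ _ Kn) mn /=; rewrite ltnNge mn.
Qed.

Let large_converges m : k = Some m -> (2 <= m)%N /\
  (\sum_(0 <= l <oo) ((d l)%:R * fine (tail R d l.+1) ^+ (m - 2))%:E < +oo)%E.
Proof.
rewrite /k /threshold /min_or_infinity; case: pselect => // ex [<-].
case: ex_minnP => {}m /asboolP[m2 sum_lty] _; split=> //.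
have d0 : d 0%N = 0%N by have [/(_ 0%N)] := hA; rewrite leqn0 => /eqP.
rewrite (nneseries_split 0 1) => [|l _]; last first.
  by rewrite lee_fin mulr_ge0 // exprn_ge0 // fine_tail_ge0.
rewrite add0n big_nat1 d0 mul0r add0e; apply: le_lt_trans sum_lty.
rewrite le_eqVlt; apply/orP; left; apply/eqP; apply: eq_eseriesr => l _.
by rewrite EFinM EFin_expe -tailE.
Qed.

Let ae_shapes : {ae P, forall w i q N, (0 < i)%N -> lt_or_infinity i k ->
  tree_shape i q -> exists s, [/\ sorted ltn s, size s = i,
    (N <= nth 0 s 0)%N & occurs (parent A w) q s]}.
Proof.
have weight_oo i : (0 < i)%N -> lt_or_infinity i k ->
    forall K N, exists M, K <= total_weight R d i N M.
  case: i => [//|[|n]] _ ik K N; first exact: total_weight1_ge.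
  exact/total_weight2_ge/small_diverges.
(* Only the values of [q] below [i] matter, so countably many shapes suffice. *)
have : {ae P, forall w (c : seq (option nat)), (0 < size c)%N ->
    lt_or_infinity (size c) k -> tree_shape (size c) (nth None c) ->
    forall N, exists s, [/\ sorted ltn s, size s = size c,
      (N <= nth 0 s 0)%N & occurs (parent A w) (nth None c) s]}.
  apply: ae_forall_countable => c.
  have [c0|c0] := pselect (0 < size c)%N; last by apply: aeW.
  have [ck|ck] := pselect (lt_or_infinity (size c) k); last by apply: aeW.
  have [shc|shc] := pselect (tree_shape (size c) (nth None c)); last by apply: aeW.
  have := ae_shape_occurs d01 hA x_lty c0 shc (weight_oo _ c0 ck).
  by apply: filterS => w h _ _ _.
apply: filterS => w h i q N i0 ik shq; have := h (mkseq q i).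
rewrite size_mkseq => {}h.
have qE j : (j < i)%N -> nth None (mkseq q i) j = q j by move=> ji; rewrite nth_mkseq.
have shc : tree_shape i (nth None (mkseq q i)).
  by move=> j ji; have := shq j ji; rewrite qE //; case: j ji.
have [s [ss si sN [eqs cs]]] := h i0 ik shc N.
by exists s; split=> //; split=> // j js; rewrite eqs // qE // -si.
Qed.

Let ae_finitely_many_big : {ae P, forall w,
  finite_set [set v | ~ lt_or_infinity #|` component (parent A w) v| k]}.
Proof.
case kE: k => [m|]; last first.
  apply: aeW => w; rewrite (_ : [set _ | _] = set0) //.
  by apply/seteqP; split=> // v /=.
have [m2 sum_lty] := large_converges kE.
have := ae_finitely_many_large d01 hA x_lty sum_lty.
have := ae_finite_components d01 hA x_lty; apply: filterS2 => w fin.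
set p := parent A w; set L := [set l | _] => Lfin.
have p_lt : parent_decreases p := @parent_ltn _ _ A w.
have : finite_set (\bigcup_(l in L) [set v | root_of p v = root_of p l]).
  by apply: bigcup_finite => // l _; exact: fin.
apply: sub_finite_set => v /= /negP; rewrite -leqNgt => mv.
pose s := sort leq (component p v).
have ss : sorted ltn s.
  by rewrite ltn_sorted_uniq_leq sort_uniq fset_uniq sort_sorted //; exact: leq_total.
have sr u : u \in s <-> root_of p u = root_of p v.
  rewrite mem_sort in_component; last by move=> v'; exact: fin.
  by split=> /eqP.
(* [r] and [l] below are the two smallest vertices of the component of [v]. *)
have [q [shq eq]] := component_embeds p_lt ss sr m.
have st : size (take m s) = m by rewrite size_takel // size_sort.
rewrite st in shq; have sst : sorted ltn (take m s).
  by apply: subseq_sorted ltn_trans _ _ (take_subseq _ _) ss.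
case tE: (take m s) => [|r [|l s']]; try by move: m2; rewrite -st tE.
exists l; last first.
  have /sr -> // : l \in s by apply: (mem_take (n0 := m)); rewrite tE !inE eqxx orbT.
rewrite tE in sst eq st; have sm : (size s').+2 = m by rewrite -st.
exists r, s', q; split=> //; first by rewrite -sm !subSS subn0.
by rewrite (_ : (m - 2).+2 = m) // -sm !subSS subn0.
Qed.

(** Here [big] is the set of the vertices of the components with [k] vertices or
    more. It is empty if [k] is infinite, and the isomorphism type of the graph
    is then constant. *)
Let ae_decomposition : {ae P, forall w, exists big : {fset nat},
  (k = None -> big = fset0) /\
  iso (random_graph A w) (gsum (pullback (fun v : big => val v)
    (parent_graph (parent A w))) (F_below k))}.
Proof.
have shapes_and_big : {ae P, forall w, (forall i q N, (0 < i)%N ->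
    lt_or_infinity i k -> tree_shape i q -> exists s, [/\ sorted ltn s, size s = i,
      (N <= nth 0 s 0)%N & occurs (parent A w) q s]) /\
    finite_set [set v | ~ lt_or_infinity #|` component (parent A w) v| k]}.
  by move: ae_shapes ae_finitely_many_big; apply: filterS2.
move: (ae_random_graph d01 hA) (ae_finite_components d01 hA x_lty) shapes_and_big.
apply: filterS3 => w wG fin [shapes bigfin].
exists (fset_set [set v | ~ lt_or_infinity #|` component (parent A w) v| k]).
split=> [kN|].
  rewrite (_ : [set _ | _] = set0) ?fset_set0 //.
  by apply/seteqP; split=> // v /=; rewrite kN => /(_ I).
apply: iso_trans wG _; apply: parent_graph_F_below => //.
  exact: parent_ltn.
by move=> v; rewrite in_fset_set // inE.
Qed.

Lemma convergent_atom (V : Type) (G : sgraph V) : atom P A G ->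
  exists (W : finType) (F : sgraph W), acyclic F /\ iso G (gsum F (F_below k)).
Proof.
move=> /(atom_ae ae_decomposition)[w [big [_ wF]] /iso_sym wG].
exists big, (pullback (fun v : big => val v) (parent_graph (parent A w))); split.
  by apply: acyclic_inj (@parent_graph_acyclic (parent A w)); [exact: val_inj|].
exact: iso_trans wG wF.
Qed.

Lemma infinite_threshold_concentrated : k = None -> concentrated P A.
Proof.
move=> kN; pose G0 : sgraph void := pullback (of_void nat) (parent_graph (fun=> None)).
exists _, (gsum G0 (F_below k)); apply: filterS ae_decomposition => w [big [+ wF]].
move=> /(_ kN) big0; subst big; apply: iso_trans wF _; apply: gsum_iso_l.
have no (v : fset0 (K := nat)) : False by case: v => v; rewrite in_fset0.
exists (fun v => match no v with end); split; last by move=> v; case: (no v).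
by exists (of_void _) => v; case: (no v) || case: v.
Qed.

Let large_not_negligible n :
  ~ P.-negligible [set w | has_component_ge n (random_graph A w)].
Proof.
move=> nneg; have [J [uJ Jn J0]] := star_not_negligible d01 hA n dinf; apply.
apply: negligibleS (negligibleU nneg (ae_random_graph d01 hA)) => w wJ.
have [wG|] := pselect (iso (random_graph A w) (parent_graph (parent A w))); last by right.
left=> /=; apply: has_component_ge_iso (iso_sym wG) _.
have r0 i : i \in J -> reachable (parent_graph (parent A w)) i 0%N.
  by move=> iJ; apply: rt_step; apply/parent_adj; [exact: parent_ltn|left; exact: wJ].
exists (fun i : 'I_n => nth 0%N J i); split.
  by move=> i j /eqP; rewrite nth_uniq ?Jn ?ltn_ord // => /eqP/val_inj.
move=> i j; apply: rt_trans (r0 _ _) _; first by rewrite mem_nth // Jn.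
by apply/reachable_sym/r0; rewrite mem_nth // Jn.
Qed.

(** Almost every graph belongs to a countable family, so one of its members
    with a component of at least [n] vertices has positive probability. *)
Let large_atom n : exists u, atom P A (gsum (listed_graph u) (F_below k)) /\
  has_component_ge n (gsum (listed_graph u) (F_below k)).
Proof.
apply: contrapT => noatom; apply: (@large_not_negligible n).
pose G u := gsum (listed_graph u) (F_below k).
have : {ae P, forall w u, has_component_ge n (G u) -> ~ iso (random_graph A w) (G u)}.
  apply: ae_forall_countable => u.
  have [lu|nlu] := pselect (has_component_ge n (G u)); last by apply: aeW.
  have : P.-negligible [set w | iso (random_graph A w) (G u)].
    by apply: contrapT => au; apply: noatom; exists u.
  by apply: negligibleS => w /= /not_implyP[_ /contrapT].
move=> h; apply: negligibleS (negligibleU h ae_decomposition) => w wn.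
have [[big [_ wF]]|] := pselect (exists big : {fset nat},
  (k = None -> big = fset0) /\ iso (random_graph A w) (gsum (pullback
  (fun v : big => val v) (parent_graph (parent A w))) (F_below k))); last by right.
left=> /= noiso; have [u Fu] := finite_graph_listed (pullback
  (fun v : big => val v) (parent_graph (parent A w))).
have wu := iso_trans wF (gsum_iso_l (F_below k) Fu).
by apply: (noiso u) => //; exact: has_component_ge_iso wu wn.
Qed.

(** Component sizes are bounded in each member of the family, and [a] is chosen
    so that the [j]-th atom has a component larger than all those of the
    preceding atoms. *)
Lemma finite_threshold_infinitely_many_atoms m :
  k = Some m -> infinitely_many_atoms P A.
Proof.
move=> km; have /choice[U Uatom] := large_atom.
pose G u := gsum (listed_graph u) (F_below k).
pose b n := ((U n).1 + m).+1.
have Ub n : ~ has_component_ge (b n) (G (U n)).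
  by rewrite /G km; exact: no_large_component.
have b_gt n : (n < b n)%N.
  rewrite ltnNge; apply/negP => bn; apply: (Ub n).
  exact: has_component_ge_le bn (Uatom n).2.
pose a := fix a j := if j is j'.+1 then b (a j') else 0%N.
have a_mono i j : (i <= j)%N -> (a i <= a j)%N.
  elim: j => [|j ih]; first by rewrite leqn0 => /eqP ->.
  rewrite leq_eqVlt => /predU1P[->//|/ih ij].
  exact: leq_trans ij (ltnW (b_gt _)).
have noniso i j : (i < j)%N -> ~ iso (G (U (a j))) (G (U (a i))).
  move=> ij; move/has_component_ge_iso => /(_ (b (a i))) h; apply: (Ub (a i)); apply: h.
  exact: has_component_ge_le (a_mono _ _ ij) (Uatom (a j)).2.
exists _, (fun j => G (U (a j))); split=> [j|i j /eqP]; first exact: (Uatom (a j)).1.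
rewrite neq_ltn => /orP[ij|ji]; first by move=> /iso_sym; exact: noniso.
exact: noniso.
Qed.

End Convergent.

Theorem theorem2p5 (R : realType) (disp : measure_display)
    (T : measurableType disp) (P : probability T R)
    (d : nat -> nat) (A : forall i : nat, T -> {set 'I_i})
    (d01 : forall n, d n = 0%N \/ d n = 1%N) (d0 : d 0%N = 0%N)
    (dinf : infinite_set [set n | d n = 1%N])
    (hA : graph_process P d A) :
  ((\sum_(1 <= i <oo) ((d i)%:R / i%:R : R)%:E = +oo)%E ->
    concentrated P A /\
    forall (V : Type) (G : sgraph V), atom P A G ->
      (forall C, components G C -> omega_tree (induced_subgraph G C)) /\
      components G #= [set n | d n = 0%N]) /\
  ((\sum_(1 <= i <oo) ((d i)%:R / i%:R : R)%:E < +oo)%E ->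
    (if threshold R d is Some _ then infinitely_many_atoms P A
     else concentrated P A) /\
    forall (V : Type) (G : sgraph V), atom P A G ->
      exists (W : finType) (F : sgraph W),
        acyclic F /\ iso G (gsum F (F_below (threshold R d)))).
Proof.
have from0 : (\sum_(1 <= i <oo) ((d i)%:R / i%:R : R)%:E =
    \sum_(0 <= i <oo) (rate R d i)%:E)%E.
  rewrite (nneseries_split 0 1) => [|i _]; last by rewrite lee_fin rate_ge0.
  by rewrite add0n big_nat1 rate0 add0e.
rewrite from0; split=> [x_oo|x_lty]; split.
- exact: divergent_concentrated d01 hA x_oo.
- by move=> V G aG; apply: divergent_atom d01 hA x_oo _ _ aG.
- case kE: (threshold R d) => [m|].
    exact: finite_threshold_infinitely_many_atoms kE.
  exact: infinite_threshold_concentrated kE.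
- by move=> V G aG; apply: convergent_atom d01 hA x_lty _ _ aG.
Qed.
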